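(* Let $F:\mathbb{R}_{\ge 0}\to\mathbb{R}$ be an increasing function such that $$\int_{B(0,1)}\big|F(|c_1(\alpha)|)\big|^2\,d\mu<\infty,$$ and for any natural number $n$ and non-negative real numbers $d_1,\dots,d_n$ let $$M_{F,n}(d_1,\dots,d_n)=F^{-1}\left(\frac{F(d_1)+\cdots+F(d_n)}{n}\right).$$ Let $(a_n,b_n)_{n=1}^\infty$ be a Stoltz sequence of pairs of natural numbers. Then $$\lim_{n\to\infty}M_{F,b_n}\big(|c_{a_n+1}(\alpha)|,\dots,|c_{a_n+b_n}(\alpha)|\big)=F^{-1}\left(\int_{B(0,1)}F(|c_1(\alpha)|)\,d\mu\right)$$ for $\mu$-almost every $\alpha\in B(0,1)$.
   Context: Let $p$ be a prime and let $K$ be a finite extension of $\mathbb{Q}_p$ of degree $m$, with ramification index $e$ and residue degree $f$ (so $m=ef$). Let $|\cdot|$ be the unique extension to $K$ of the $p$-adic absolute value with $|p|=p^{-1}$. Let $L\subseteq K$ be the unramified subextension of degree $f$ over $\mathbb{Q}_p$, write $L=\mathbb{Q}_p(\gamma)$ with $\gamma$ a primitive $(p^f-1)$-th root of unity, and fix $\beta\in K$ with $K=L(\beta)$ and $|\beta|=p^{1/e}$. For $b=\sum_{j\ge n_0}a_jp^j\in\mathbb{Q}_p$ with digits $a_j\in\{0,1,\dots,p-1\}$ put $\lfloor b\rfloor_p=\sum_{n_0\le j\le 0}a_jp^j$ (which is $0$ if $|b|<1$). Every $\alpha\in K$ is uniquely $\alpha=\sum_{i=0}^{e-1}\sum_{j=0}^{f-1}b_{i,j}\gamma^j\beta^i$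 with $b_{i,j}\in\mathbb{Q}_p$, and $\lfloor\alpha\rfloor=\sum_{i=0}^{e-1}\sum_{j=0}^{f-1}\lfloor b_{i,j}\rfloor_p\gamma^j\beta^i$. Let $B(0,1)=\{x\in K:|x|<1\}$, and let $\mu$ be the restriction to $B(0,1)$ (with its Borel $\sigma$-algebra) of the Haar measure of the additive group $K$, normalized by $\mu(B(0,1))=1$. The continued fraction map $T:B(0,1)\to B(0,1)$ is $T(\alpha)=\frac1\alpha-\left\lfloor\frac1\alpha\right\rfloor$ for $\alpha\ne 0$ and $T(0)=0$. The $n$-th partial quotient of $\alpha\in B(0,1)$ is $c_n(\alpha)=\lfloor 1/T^{n-1}(\alpha)\rfloor$ for $n\ge 1$, defined when $T^{n-1}(\alpha)\neq 0$ (so all $c_n(\alpha)$ are defined for $\mu$-almost every $\alpha$). $F^{-1}$ denotes the inverse function of $F$. Stoltz sequences: for an infinite set $\Omega\subseteq\mathbb{Z}\times\mathbb{N}$, $h\ge 0$, a real $\kappa>0$ and a positive integer $\lambda$, define $\Omega^h=\{(n,k)\in\Omega:k\ge h\}$, $\Omega^h_\kappa=\{(z,s)\in\mathbb{Z}^2:|z-y|<\kappa(s-r)\text{ for some }(y,r)\in\Omega^h\}$, and $\Omega^h_\kappa(\lambda)=\{n:(n,\lambda)\in\Omega^h_\kappa\}$. A sequence of pairs of natural numbers $(a_n,b_n)_{n\ge 1}$ is Stoltz if there exist such an $\Omega$ and a function $h=h(t)$ tending to infinity with $t$ such that $(a_n,b_n)\in\Omega^{h(t)}$ for all $n\ge t$,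 and there exist $l$, $\kappa>0$ and $A_\kappa>0$ such that $\#\Omega^l_\kappa(\lambda)\le A_\kappa\lambda$ for all positive integers $\lambda$. *)

(* Defs.v *)
From HB Require Import structures.
From mathcomp Require Import all_boot all_order all_algebra all_field finmap.
From mathcomp Require Import all_classical all_reals all_analysis.

Set Implicit Arguments.
Unset Strict Implicit.
Unset Printing Implicit Defensive.

Import Order.TTheory GRing.Theory Num.Theory.
Import numFieldNormedType.Exports.

Local Open Scope classical_set_scope.
Local Open Scope ring_scope.

(* The library's normedZmodType cannot serve for absolute values of fields: it
   requires `|x *+ n| = `|x| *+ n, which fails p-adically. *)
Record absolute_value (R : realType) (K : fieldType) := AbsoluteValue {
  absval :> K -> R;
  absval_ge0 : forall x, 0 <= absval x;
  absval_eq0 : forall x, absval x = 0 <-> x = 0;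
  absvalM : forall x y, absval (x * y) = absval x * absval y;
  absval_triangle : forall x y, absval (x + y) <= absval x + absval y
}.

(* The carrier K with the topology of the metric (x, y) |-> v (x - y). *)
Definition metric_of (R : realType) (K : fieldType)
  (v : absolute_value R K) : Type := K.

Section MetricOf.
Context (R : realType) (K : fieldType) (v : absolute_value R K).

HB.instance Definition _ := Choice.on (metric_of v).
HB.instance Definition _ := isPointed.Build (metric_of v) (0 : K).

Let dist (x y : metric_of v) : R := v ((x : K) - y).

Let dist_xx x : dist x x = 0.
Proof. by rewrite /dist subrr; apply/absval_eq0. Qed.

Let dist_eq0 x y : dist x y = 0 -> x = y.
Proof. by move/absval_eq0/eqP; rewrite subr_eq0 => /eqP. Qed.

Let absval1 : v 1 = 1.
Proof.
have v1N0 : v 1 != 0 by apply/eqP => /absval_eq0/eqP; rewrite oner_eq0.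
by apply: (mulfI v1N0); rewrite -absvalM !mulr1.
Qed.

Let absvalN x : v (- x) = v x.
Proof.
have : v (-1) ^+ 2 = 1 by rewrite expr2 -absvalM mulrNN mulr1 absval1.
move/eqP; rewrite sqrp_eq1 ?absval_ge0// => /eqP vN1.
by rewrite -mulN1r absvalM vN1 mul1r.
Qed.

Let dist_sym x y : dist x y = dist y x.
Proof. by rewrite /dist -absvalN opprB. Qed.

Let dist_triangle y x z : dist x z <= dist x y + dist y z.
Proof.
rewrite /dist (_ : (x : K) - z = ((x : K) - y) + ((y : K) - z)).
  exact: absval_triangle.
by rewrite addrA subrK.
Qed.

HB.instance Definition _ := @isMetric.Build R (metric_of v)
  dist dist_xx dist_eq0 dist_sym dist_triangle.

End MetricOf.

(* K with its Borel sigma-algebra. *)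
Definition borel_of (R : realType) (K : fieldType) (v : absolute_value R K) :=
  g_sigma_algebraType (@open (metric_of v)).

(* The open unit ball B(0,1). *)
Definition unit_ball (R : realType) (K : fieldType) (v : absolute_value R K)
  : set (borel_of v) := [set x : K | v x < 1].
Arguments unit_ball {R K} v _.

(* Haar measures of the (abelian, locally compact) additive group K. *)
Record is_haar (R : realType) (K : fieldType) (v : absolute_value R K)
    (mu : {measure set (borel_of v) -> \bar R}) : Prop := {
  haar_translation : forall (x : K) (A : set (borel_of v)), measurable A ->
    mu ([set x + y | y in (A : set K)] : set (borel_of v)) = mu A;
  haar_compact : forall A : set (metric_of v), compact A -> (mu A < +oo)%E;
  haar_outer_regular : forall A : set (borel_of v), measurable A ->
    mu A = ereal_inf [set mu U | U in
      [set U : set (metric_of v) | open U /\ A `<=` U]];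
  haar_inner_regular : forall U : set (metric_of v), open U ->
    mu U = ereal_sup [set mu C | C in
      [set C : set (metric_of v) | compact C /\ C `<=` U]];
  haar_neq0 : mu setT <> 0%E
}.

Definition padic_abs_rat (R : realType) (p : nat) (q : rat) : R :=
  if q == 0 then 0 else
  p%:R ^ ((logn p `|denq q|%N)%:Z - (logn p `|numq q|%N)%:Z).

(* (Q, v) is the field of p-adic numbers, i.e. the completion of the rationals
   for the p-adic absolute value; this determines (Q, v) up to a unique
   isometric isomorphism. *)
Record is_padic (R : realType) (p : nat) (Q : fieldType)
    (v : absolute_value R Q) : Prop := {
  padic_rat : forall q : rat, v (ratr q) = padic_abs_rat R p q;
  padic_dense : dense (range (ratr : rat -> metric_of v));
  padic_complete : forall G : set_system (metric_of v),
    ProperFilter G -> cauchy G -> cvg G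
}.

Section LocalField.
Context (R : realType) (Q : fieldType) (K : fieldExtType Q).
Context (v : absolute_value R K).

(* The index of the value group of Q in the value group of E is e: t is a
   family of representatives of the cosets. *)
Definition ramification_index (E : {vspace K}) (e : nat) : Prop :=
  exists t : 'I_e -> K,
    (forall i, t i \in E /\ t i != 0) /\
    (forall x, x \in E -> x != 0 ->
       exists! i, exists2 q : Q, q != 0 & v x = v q%:A * v (t i)).

(* The residue field of E has dimension f over that of Q: the residue classes
   of the t i form a basis. *)
Definition residue_degree (E : {vspace K}) (f : nat) : Prop :=
  exists t : 'I_f -> K,
    [/\ forall i, t i \in E /\ v (t i) <= 1,
        forall x, x \in E -> v x <= 1 ->
          exists2 c : 'I_f -> Q, forall i, v (c i)%:A <= 1
                               & v (x - \sum_(i < f) c i *: t i) < 1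
      & forall c : 'I_f -> Q, (forall i, v (c i)%:A <= 1) ->
          v (\sum_(i < f) c i *: t i) < 1 -> forall i, v (c i)%:A < 1].

End LocalField.

Section ContinuedFraction.
Context (R : realType) (p : nat) (Q : fieldType) (vQ : absolute_value R Q).
Context (K : fieldExtType Q) (e f : nat) (gamma beta : K).

(* a k is the digit of b at p ^ (k - N); since zero digits may be prepended,
   taking N >= 0 loses no generality, and the terms of exponent at most 0 are
   those with k <= N. *)
Definition padic_floor (b : Q) : Q :=
  xget 0 [set y | exists (N : nat) (a : nat -> nat),
    [/\ forall k, (a k < p)%N,
        (fun n => (\sum_(k < n) (a k)%:R * p%:R ^ (k%:Z - N%:Z))
           : metric_of vQ) @ \oo --> (b : metric_of vQ)
      & y = \sum_(k < N.+1) (a k)%:R * p%:R ^ (k%:Z - N%:Z)]].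

Definition from_coeffs (b : 'M[Q]_(e, f)) : K :=
  \sum_(i < e) \sum_(j < f) b i j *: (gamma ^+ j * beta ^+ i).

Definition coeffs (alpha : K) : 'M[Q]_(e, f) :=
  xget 0 [set b | alpha = from_coeffs b].

Definition floor_part (alpha : K) : K :=
  from_coeffs (map_mx padic_floor (coeffs alpha)).

Definition cf_map (alpha : K) : K :=
  if alpha == 0 then 0 else alpha^-1 - floor_part alpha^-1.

(* Meaningful for n >= 1 and iter n.-1 cf_map alpha != 0. *)
Definition partial_quotient (n : nat) (alpha : K) : K :=
  floor_part (iter n.-1 cf_map alpha)^-1.

End ContinuedFraction.

Section QuasiArithmeticMean.
Context (R : realType) (F : R -> R).

(* The inverse of an increasing F on the nonnegative reals (see inv_funK).  No
   continuity is assumed, so an average of values of F may fall into a jump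
   [F(x-), F(x+)] of F; there inv_fun takes the value x, the only value that
   keeps the inverse monotone. *)
Definition inv_fun (y : R) : R := sup [set x | 0 <= x /\ F x <= y].

Definition qa_mean (n : nat) (d : 'I_n -> R) : R :=
  inv_fun ((\sum_(i < n) F (d i)) / n%:R).

Lemma inv_funK : (forall x y, 0 <= x -> x < y -> F x < F y) ->
  forall x, 0 <= x -> inv_fun (F x) = x.
Proof.
move=> Finc x x0.
have ubx : ubound [set z | 0 <= z /\ F z <= F x] x.
  move=> z [_ FzFx]; rewrite leNgt; apply/negP => xz.
  by move: (Finc _ _ x0 xz); rewrite ltNge FzFx.
apply/le_anti/andP; split.
  by apply: ge_sup => //; exists x.
by apply: ub_le_sup => //; exists x.
Qed.

End QuasiArithmeticMean.

Section Stoltz.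
Context (R : realType).

Definition above (Omega : set (int * nat)) (h : R) : set (int * nat) :=
  [set nk | Omega nk /\ h <= nk.2%:R].

Definition cone (Omega : set (int * nat)) (h kappa : R) : set (int * int) :=
  [set zs | exists2 yr, above Omega h yr &
     `|zs.1 - yr.1|%:~R < kappa * (zs.2 - yr.2%:Z)%:~R].

Definition cone_section (Omega : set (int * nat)) (h kappa : R)
  (lambda : nat) : set int := [set n | cone Omega h kappa (n, lambda%:Z)].

(* The sequence is indexed by n >= 1; the values at 0 are irrelevant. *)
Definition stoltz (a b : nat -> nat) : Prop :=
  exists (Omega : set (int * nat)) (h : nat -> R),
    [/\ infinite_set Omega,
        (forall t, 0 <= h t) /\ h t @[t --> \oo] --> +oo,
        forall t n, (1 <= n)%N -> (t <= n)%N ->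
          above Omega (h t) ((a n)%:Z, b n)
      & exists l kappa A : R, [/\ 0 <= l, 0 < kappa, 0 < A &
          forall lambda : nat, (0 < lambda)%N ->
            finite_set (cone_section Omega l kappa lambda) /\
            (#|` fset_set (cone_section Omega l kappa lambda)|)%:R
              <= A * lambda%:R]].

End Stoltz.

(* Main.v *)
(* The elements gamma ^+ j * beta ^+ i (j < f, i < e) form a basis of K over Qp
   in which x has absolute value < 1 iff all its coordinates do: the residues of
   the gamma ^+ j form a basis of the residue field, the beta ^+ i represent the
   value group of K modulo that of Qp, and completeness gives spanning. Hence
   the values of the floor function represent K / B(0,1). For each such value c
   with |c| > 1, the map x |-> 1 / (c + x) is a similarity of B(0,1) onto the
   cylinder {c_1 = c}, so by uniqueness of a measure giving equal mass to balls
   of equal radius, mu (c_1 = c, T in A) = mu (c_1 = c) * mu A. Thus T preserves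
   mu and the partial quotients are independent and identically distributed.

   It remains to prove a strong law of large numbers for the pairwise
   uncorrelated, nonnegative, square integrable X_k = F |c_(k+1)| - F 0 along the
   windows [a_n, a_n + b_n). For s a power of 2 and q fixed, the windows with
   q s <= b_n < 2 q s meet only boundedly many blocks [i s, (i+1) s), by the
   Stoltz condition; the mean square deviation of the averages over these blocks
   is O(1 / s), which is summable over s, so all these block averages converge
   almost everywhere. As X_k >= 0, a window average lies between block averages
   up to a relative error O(1 / q). *)

Require Import Defs.
From HB Require Import structures.
From mathcomp Require Import all_boot all_order all_algebra all_field finmap.
From mathcomp Require Import all_classical all_reals all_analysis measurable_realfun.
From mathcomp Require Import ring lra zify.

Set Implicit Arguments.
Unset Strict Implicit.
Unset Printing Implicit Defensive.

Import Order.TTheory GRing.Theory Num.Theory.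
Import numFieldNormedType.Exports.

Local Open Scope classical_set_scope.
Local Open Scope ring_scope.

(** * Ultrametric absolute values *)

Section AbsoluteValue.
Context (R : realType) (K : fieldType) (v : absolute_value R K).

Lemma absval0 : v 0 = 0. Proof. by apply/absval_eq0. Qed.

Lemma absval_gt0 x : (0 < v x) = (x != 0).
Proof.
rewrite lt_def absval_ge0 andbT; congr (~~ _).
by apply/eqP/eqP => [/absval_eq0|->]; last exact: absval0.
Qed.

Lemma absval1 : v 1 = 1.
Proof.
have v1 : v 1 != 0 by rewrite gt_eqF// absval_gt0 oner_eq0.
by apply: (mulfI v1); rewrite -absvalM !mulr1.
Qed.

Lemma absvalN x : v (- x) = v x.
Proof.
have : v (-1) ^+ 2 = 1 by rewrite expr2 -absvalM mulrNN mulr1 absval1.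
move/eqP; rewrite sqrp_eq1 ?absval_ge0// => /eqP vN1.
by rewrite -mulN1r absvalM vN1 mul1r.
Qed.

Lemma absvalB x y : v (x - y) = v (y - x).
Proof. by rewrite -absvalN opprB. Qed.

Lemma absvalX x n : v (x ^+ n) = v x ^+ n.
Proof. by elim: n => [|n IH]; rewrite ?expr0 ?absval1// !exprS absvalM IH. Qed.

Lemma absvalV x : v x^-1 = (v x)^-1.
Proof.
have [->|x0] := eqVneq x 0; first by rewrite invr0 absval0 invr0.
have vx0 : v x != 0 by rewrite gt_eqF// absval_gt0.
by apply: (mulfI vx0); rewrite -absvalM !divff// absval1.
Qed.

Lemma absvalXz x (n : int) : v (x ^ n) = v x ^ n.
Proof.
case: n => n; first by rewrite -!exprnP absvalX.
by rewrite !NegzE -!invr_expz absvalV -!exprnP absvalX.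
Qed.

Lemma absval_sum (I : Type) (r : seq I) (P : pred I) (F : I -> K) :
  v (\sum_(i <- r | P i) F i) <= \sum_(i <- r | P i) v (F i).
Proof.
elim/big_ind2: _ => [|x1 x2 y1 y2 h1 h2|//]; first by rewrite absval0.
by apply: le_trans (absval_triangle _ _ _) _; apply: lerD.
Qed.

Definition ultrametric := forall x y, v (x + y) <= Num.max (v x) (v y).

(* Expanding (x + y) ^+ n bounds v (x + y) ^+ n by n.+1 * M ^+ n with
   M the maximum of v x and v y; a ratio v (x + y) / M > 1 would make the left
   side grow exponentially faster. *)
Lemma ultrametric_of_nat : (forall n : nat, v n%:R <= 1) -> ultrametric.
Proof.
move=> vn x y; set M := Num.max _ _.
have M0 : 0 <= M by rewrite le_max absval_ge0.
have xM : v x <= M by rewrite le_max lexx.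
have yM : v y <= M by rewrite le_max lexx orbT.
have key n : v (x + y) ^+ n <= n.+1%:R * M ^+ n.
  rewrite -absvalX exprDn; apply: le_trans (absval_sum _ _ _) _.
  rewrite mulr_natl -[n.+1 in leRHS]card_ord -sumr_const; apply: ler_sum => i _.
  rewrite -mulr_natl absvalM absvalM !absvalX.
  have -> : M ^+ n = 1 * (M ^+ (n - i) * M ^+ i).
    by rewrite mul1r -exprD subnK// -ltnS.
  apply: ler_pM => //; first exact: absval_ge0.
    by rewrite mulr_ge0// exprn_ge0// absval_ge0.
  apply: ler_pM; rewrite ?exprn_ge0 ?absval_ge0//;
    by rewrite lerXn2r ?nnegrE ?absval_ge0.
rewrite leNgt; apply/negP => ltM.
have [M00|Mn0] := eqVneq M 0.
  by have := key 1%N; rewrite !expr1 M00 mulr0 leNgt -M00 ltM.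
have {M0}M0 : 0 < M by rewrite lt_def Mn0.
set t := v (x + y) / M.
have t1 : 1 < t by rewrite ltr_pdivlMr// mul1r.
have {}key n : t ^+ n <= n.+1%:R.
  by rewrite expr_div_n ler_pdivrMr ?exprn_gt0// key.
set d := t - 1.
have d0 : 0 < d by rewrite subr_gt0.
have bern n : 1 + n%:R * d <= t ^+ n.
  elim: n => [|n IH]; first by rewrite mul0r addr0 expr0.
  rewrite exprS -natr1.
  have tE : t = 1 + d by rewrite /d; ring.
  have : t * (1 + n%:R * d) <= t * t ^+ n by rewrite ler_pM2l// (lt_trans ltr01).
  apply: le_trans; rewrite [in leRHS]tE.
  have : 0 <= n%:R * d * d by rewrite !mulr_ge0// ltW.
  nra.
(* Bernoulli's bound is only linear in the exponent, like the right side of [key], so it is squared: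
   once [N * d ^+ 2 >= 2], the square of [1 + N * d] exceeds [2 * N + 1]. *)
pose N := (Num.bound (2 / d ^+ 2)).+1.
have HN : 2 <= N%:R * d ^+ 2.
  rewrite -ler_pdivrMr ?exprn_gt0// ltW// (lt_le_trans (archi_boundP _))//.
    by rewrite divr_ge0// exprn_ge0// ltW.
  by rewrite ler_nat.
have : (1 + N%:R * d) ^+ 2 <= (N * 2).+1%:R.
  apply: le_trans (key _); rewrite exprM lerXn2r ?nnegrE//.
    by rewrite addr_ge0// mulr_ge0// ltW.
  by rewrite exprn_ge0// (le_trans ler01)// ltW.
have N1 : 1 <= N%:R :> R by rewrite ler1n.
have Nd : 0 < N%:R * d by rewrite mulr_gt0// (lt_le_trans ltr01).
rewrite -natr1 natrM leNgt => /negP; apply.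
nra.
Qed.

Hypothesis vU : ultrametric.

Lemma ultraD x y r : v x < r -> v y < r -> v (x + y) < r.
Proof. by move=> xr yr; apply: le_lt_trans (vU x y) _; rewrite gt_max xr. Qed.

Lemma ultraDle x y r : v x <= r -> v y <= r -> v (x + y) <= r.
Proof. by move=> xr yr; apply: le_trans (vU x y) _; rewrite ge_max xr. Qed.

Lemma ultraB x y r : v x < r -> v y < r -> v (x - y) < r.
Proof. by move=> xr yr; apply: ultraD; rewrite ?absvalN. Qed.

(** In the ultrametric bound for [x = (x + y) - y] the maximum cannot be [v y]. *)
Lemma ultraDeq x y : v y < v x -> v (x + y) = v x.
Proof.
move=> yx; apply/le_anti/andP; split.
  by apply: le_trans (vU x y) _; rewrite ge_max lexx ltW.
have := vU (x + y) (- y); rewrite addrK absvalN le_max => /orP[//|].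
by rewrite leNgt yx.
Qed.

Lemma ultra_eq x y : v (x - y) < v x -> v y = v x.
Proof.
move=> h; rewrite -(@ultraDeq x (- (x - y))) ?absvalN//.
by rewrite opprB addrC subrK.
Qed.

Lemma ultra_trans y x z r : v (x - y) < r -> v (y - z) < r -> v (x - z) < r.
Proof.
by move=> xy yz; rewrite -(subrK y x) -addrA; exact: ultraD.
Qed.

Lemma ultra_sum (I : Type) (s : seq I) (P : pred I) (F : I -> K) r : 0 < r ->
  (forall i, P i -> v (F i) < r) -> v (\sum_(i <- s | P i) F i) < r.
Proof.
move=> r0 Fr; elim/big_ind: _ => [|x y|//]; first by rewrite absval0.
exact: ultraD.
Qed.

Lemma ultra_sum_le (I : Type) (s : seq I) (P : pred I) (F : I -> K) r : 0 <= r ->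
  (forall i, P i -> v (F i) <= r) -> v (\sum_(i <- s | P i) F i) <= r.
Proof.
move=> r0 Fr; elim/big_ind: _ => [|x y|//]; first by rewrite absval0.
exact: ultraDle.
Qed.

(** A nonzero summand of largest absolute value strictly dominates each other summand, hence their
    sum, so the total has the absolute value of that summand. *)
Lemma ultra_sum_distinct (I : finType) (F : I -> K) :
  (forall i j, F i != 0 -> i != j -> v (F i) != v (F j)) ->
  forall i, v (F i) <= v (\sum_j F j).
Proof.
move=> Fd i; pose k := [arg max_(j > i) v (F j)]%O.
have kP j : v (F j) <= v (F k) by rewrite /k; case: Order.TotalTheory.arg_maxP => // l _; apply.
apply: le_trans (kP i) _.
have [Fk0|Fk0] := eqVneq (F k) 0; first by rewrite Fk0 absval0 absval_ge0.
rewrite (bigD1 k)//= ultraDeq//; apply: ultra_sum; first by rewrite absval_gt0.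
by move=> j jk; rewrite lt_neqAle kP andbT eq_sym Fd// eq_sym.
Qed.
End AbsoluteValue.

(** * p-adic numbers *)

Lemma ball_metric_of (R : realType) (K : fieldType) (v : absolute_value R K)
  (x y : metric_of v) r : ball x r y = (v ((x : K) - y) < r) :> Prop.
Proof. by []. Qed.

Section Padic.
Context (R : realType) (p : nat) (hp : prime p) (Q : fieldType).
Context (w : absolute_value R Q) (hw : is_padic p w).

Lemma padic_nat n : (0 < n)%N -> w n%:R = p%:R ^- logn p n.
Proof.
move=> n0; have := padic_rat hw n%:R; rewrite ratr_nat => ->.
rewrite /padic_abs_rat pnatr_eq0 gtn_eqF// (_ : n%:R = n%:Z%:~R :> rat)// numq_int denq_int/= logn1.
by rewrite sub0r -exprnN.
Qed.

Lemma padic_p : w p%:R = p%:R^-1.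
Proof. by rewrite padic_nat ?prime_gt0// logn_prime// eqxx expr1. Qed.

Lemma padic_p_neq0 : p%:R != 0 :> Q.
Proof.
by rewrite -(absval_gt0 w) padic_p invr_gt0 ltr0n prime_gt0.
Qed.

Lemma padic_p_lt1 : w p%:R < 1.
Proof. by rewrite padic_p invf_lt1 ?ltr1n ?prime_gt1// ltr0n prime_gt0. Qed.

Lemma padic_nat_le1 n : w n%:R <= 1.
Proof.
case: n => [|n]; first by rewrite absval0.
by rewrite padic_nat// invf_le1 ?exprn_gt0 ?exprn_ege1 ?ler1n ?ltr0n ?prime_gt0.
Qed.

Lemma padic_int_abs (z : int) : w z%:~R = w `|z|%:R.
Proof. by case: z => n //; rewrite NegzE mulrNz absvalN. Qed.

Lemma padic_int_le1 (z : int) : w z%:~R <= 1.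
Proof. by rewrite padic_int_abs padic_nat_le1. Qed.

Lemma padic_int_lt1 (z : int) : (w z%:~R < 1) = (p %| z)%Z.
Proof.
rewrite padic_int_abs dvdzE/=; apply/idP/idP => [|/dvdnP[k ->]]; last first.
  rewrite natrM absvalM; apply: le_lt_trans padic_p_lt1.
  by rewrite ler_piMl ?absval_ge0// padic_nat_le1.
apply: contraTT => pz; rewrite -leNgt padic_nat.
  by rewrite lognE (negbTE pz) !andbF expr0 invr1.
by case: (`|z|)%N pz; rewrite ?dvdn0.
Qed.

Lemma padic_nat_lt1 (n : nat) : (w n%:R < 1) = (p %| n)%N.
Proof. by have := padic_int_lt1 n; rewrite dvdzE. Qed.

Lemma padic_ultrametric : ultrametric w.
Proof. exact: (ultrametric_of_nat padic_nat_le1). Qed.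
Let wU := padic_ultrametric.

Lemma padic_approx x r : 0 < r -> exists q : rat, w (x - ratr q) < r.
Proof.
move=> r0; have x0 : nbhs (x : metric_of w) (ball (x : metric_of w) r).
  exact: nbhsx_ballx.
have [|y [/interior_subset yx [q _ qy]]] :=
    padic_dense hw _ (@open_interior _ (ball (x : metric_of w) r)).
  by exists x.
by exists q; rewrite qy.
Qed.

(** A rational closer to [x] than [w x] has the same absolute value as [x], and for rationals the
    value is explicit. *)
Lemma padic_val x : x != 0 -> exists n : int, w x = p%:R ^ n.
Proof.
move=> x0; have wx0 : 0 < w x by rewrite absval_gt0.
have [q /(ultra_eq wU) xq] := padic_approx x wx0.
have := padic_rat hw q; rewrite xq /padic_abs_rat.
case: ifP => [_ wx|_ ->]; first by rewrite wx ltxx in wx0.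
by eexists.
Qed.

(** A rational [q] close to [x] satisfies [w q <= 1], so its reduced denominator is prime to [p];
    the digit is the residue of [q] modulo [p]. *)
Lemma padic_digit x : w x <= 1 -> exists2 d : nat, (d < p)%N & w (x - d%:R) < 1.
Proof.
move=> x1; have [q xq] := padic_approx x ltr01.
have q1 : w (ratr q) <= 1.
  rewrite -(subrK x (ratr q)); apply: ultraDle => //.
  by rewrite -absvalN opprB ltW.
have m0 : (0 < `|denq q|)%N by rewrite absz_gt0 denq_neq0.
have qE : ratr q = (numq q)%:~R / `|denq q|%:R :> Q.
  by rewrite /ratr -{1}absz_denq.
have m_neq0 : `|denq q|%:R != 0 :> Q.
  by rewrite -(absval_gt0 w) padic_nat// invr_gt0 exprn_gt0// ltr0n prime_gt0.
have pm : ~~ (p %| `|denq q|)%N.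
  apply/negP => pm; have := coprime_num_den q.
  move: (pm); rewrite -padic_nat_lt1 => wm.
  rewrite /coprime => /eqP g1.
  have : ~~ (p %| `|numq q|)%N.
    apply: contraTN (prime_gt1 hp) => pn; rewrite -leqNgt.
    by rewrite dvdn_leq// -g1 dvdn_gcd pn.
  rewrite -padic_nat_lt1 -leNgt -padic_int_abs => wn.
  move: q1; rewrite qE absvalM absvalV ler_pdivrMr ?absval_gt0// mul1r.
  by rewrite leNgt (lt_le_trans wm).
have wm : w `|denq q|%:R = 1.
  apply/eqP; rewrite eq_le padic_nat_le1 leNgt.
  by rewrite padic_nat_lt1.
have cpm : coprime `|denq q| p by rewrite coprime_sym prime_coprime.
(* By Bezout, [k] inverts the denominator of [q] modulo [p], so [numq q * k] represents the residue
   of [q]. *)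
have [k k' kk _] := egcdnP p m0.
rewrite (eqP cpm) in kk.
have p0 : p%:Z != 0 by rewrite gt_eqF// ltz_nat prime_gt0.
pose d := `|(numq q * k%:Z %% p%:Z)%Z|%N.
have dE : d%:Z = (numq q * k%:Z %% p%:Z)%Z by rewrite /d gez0_abs// modz_ge0.
exists d; first by rewrite -ltz_nat dE ltz_pmod// ltz_nat prime_gt0.
apply: (ultra_trans wU xq); rewrite qE.
have -> : (numq q)%:~R / `|denq q|%:R - d%:R =
    (numq q - d%:Z * `|denq q|%:Z)%:~R / `|denq q|%:R :> Q.
  by rewrite intrB intrM mulrBl mulfK.
rewrite absvalM absvalV wm invr1 mulr1 padic_int_lt1.
have -> : numq q - d%:Z * `|denq q|%:Z =
    p%:Z * ((numq q * k%:Z %/ p%:Z)%Z * `|denq q|%:Z - numq q * k'%:Z).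
  have := divz_eq (numq q * k%:Z) p%:Z; rewrite -dE.
  have : k%:Z * `|denq q|%N%:Z = k'%:Z * p%:Z + 1 by rewrite -!PoszM kk PoszD.
  move: (numq q) (`|denq q|%N%:Z) ((_ %/ _)%Z) => n m t h1 h2.
  have -> : d%:Z = n * k - t * p by rewrite h2; ring.
  have -> : (n * k - t * p) * m = n * (k%:Z * m) - t * p * m by ring.
  by rewrite h1; ring.
exact: dvdz_mulr.
Qed.
End Padic.

Lemma near_geometric_lt (R : realType) (C t eps : R) : 0 <= t -> t < 1 ->
  0 < eps -> \forall n \near \oo, C * t ^+ n < eps.
Proof.
move=> t0 t1 eps0; apply: (cvgr_lt 0) => //.
by apply: (@cvg_geometric _ C); rewrite ger0_norm.
Qed.

(** * Digit expansions and the floor of a p-adic number *)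

Section PadicFloor.
Context (R : realType) (p : nat) (hp : prime p) (Q : fieldType).
Context (w : absolute_value R Q) (hw : is_padic p w).
Let wU := padic_ultrametric hp hw.
Let p_gt0 : 0 < p%:R :> R. Proof. by rewrite ltr0n prime_gt0. Qed.
Let p_gt1 : 1 < p%:R :> R. Proof. by rewrite ltr1n prime_gt1. Qed.
Let pQ : p%:R != 0 :> Q. Proof. exact: (padic_p_neq0 hp hw). Qed.
Let wpz (n : int) : w (p%:R ^ n) = p%:R ^ (- n).
Proof. by rewrite absvalXz (padic_p hp hw) exprz_inv. Qed.

Lemma padic_lt1 x : w x < 1 -> w x <= p%:R^-1.
Proof.
have [->|x0] := eqVneq x 0; first by rewrite absval0 invr_ge0 ltW.
have [n ->] := padic_val hp hw x0.
rewrite -[X in _ < X -> _](expr0z (p%:R : R)) ltr_eXz2l// => n0.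
by rewrite -[leRHS]expr1z exprz_inv ler_eXz2l//; lia.
Qed.

(** The leading digit and the shift of a p-adic integer: [x = dig x + p * step x], so iterating
    [step] reads off all digits. *)
Let dig (x : Q) : nat := xget 0%N [set d | (d < p)%N /\ w (x - d%:R) < 1].
Let step (x : Q) : Q := (x - (dig x)%:R) / p%:R.

Let digP x : w x <= 1 -> (dig x < p)%N /\ w (x - (dig x)%:R) < 1.
Proof.
move=> /(padic_digit hp hw)[d dp xd].
by have [] : [set d | (d < p)%N /\ w (x - d%:R) < 1] (dig x) by apply: (xgetPex 0%N); exists d.
Qed.

Let step_le1 x : w x <= 1 -> w (step x) <= 1.
Proof.
move=> /digP[_ /padic_lt1]; rewrite /step absvalM absvalV (padic_p hp hw) invrK.
by rewrite -ler_pdivlMr// mul1r.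
Qed.

Let iter_step_le1 x n : w x <= 1 -> w (iter n step x) <= 1.
Proof. by move=> x1; elim: n => //= n; exact: step_le1. Qed.

Let digit_sum x n :
  x = \sum_(k < n) (dig (iter k step x))%:R * p%:R ^+ k + p%:R ^+ n * iter n step x.
Proof.
elim: n => [|n IH]; first by rewrite big_ord0 add0r mul1r.
rewrite big_ord_recr/= -addrA {1}IH; congr (_ + _).
set y := iter n step x.
have yE : p%:R * step y = y - (dig y)%:R by rewrite /step mulrC divfK.
by rewrite exprSr -mulrA yE; ring.
Qed.

(** A power [p ^+ N] moves [b] into the p-adic integers, where [step] produces the digits; the
    remainder after [n] digits of [b] is at most [p ^ (N - n)]. *)
Let padic_expansion b : exists N (a : nat -> nat), (forall k, (a k < p)%N) /\
  (fun n => (\sum_(k < n) (a k)%:R * p%:R ^ (k%:Z - N%:Z)) : metric_of w) @ \oo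
    --> (b : metric_of w).
Proof.
have [N bN] : exists N : nat, w (b * p%:R ^+ N) <= 1.
  have [->|b0] := eqVneq b 0; first by exists 0%N; rewrite mul0r absval0.
  have [n bn] := padic_val hp hw b0; exists `|n|%N.
  rewrite absvalM bn exprnP wpz -expfzDr ?gt_eqF//.
  rewrite -[leRHS](expr0z (p%:R : R)) ler_eXz2l//; lia.
pose x := b * p%:R ^+ N; exists N, (fun k => dig (iter k step x)).
split=> [k|]; first by have [] := digP (iter_step_le1 k bN).
apply/cvg_ballP => eps eps0.
have pN1 : p%:R^-1 < 1 :> R by rewrite invf_lt1.
have pN0 : 0 <= p%:R^-1 :> R by rewrite invr_ge0 ltW.
apply: filterS (near_geometric_lt (p%:R ^+ N) pN0 pN1 eps0) => n nlt.
rewrite /= ball_metric_of; apply: le_lt_trans nlt.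
have -> : \sum_(k < n) (dig (iter k step x))%:R * p%:R ^ (k%:Z - N%:Z) =
    (\sum_(k < n) (dig (iter k step x))%:R * p%:R ^+ k) / p%:R ^+ N :> Q.
  rewrite mulr_suml; apply: eq_bigr => k _.
  by rewrite expfzDr// -exprnP -exprnN mulrA.
have -> : b = x / p%:R ^+ N by rewrite mulfK// expf_neq0.
rewrite -mulrBl [X in X - _](digit_sum x n) addrAC subrr add0r.
rewrite !absvalM absvalV !absvalX (padic_p hp hw) !exprVn invrK mulrC.
rewrite ler_pM2l ?exprn_gt0// -exprVn ler_piMr ?exprn_ge0//.
exact: iter_step_le1.
Qed.

Let digits_lt (a : nat -> nat) n : (forall k, (a k < p)%N) ->
  (\sum_(k < n) a k * p ^ k < p ^ n)%N.
Proof.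
move=> ap; elim: n => [|n IH]; first by rewrite big_ord0.
rewrite big_ord_recr/= expnS.
apply: (@leq_trans (p ^ n + a n * p ^ n)); first by rewrite -addSn leq_add2r.
by rewrite -mulSn leq_mul2r ap orbT.
Qed.

(** The digits of exponent at most 0 are the base [p] digits of a natural number [Y]. The bound on
    [Y] is what makes the floor unique in its class modulo the open unit ball. *)
Let padic_floor_spec b : exists N Y : nat, [/\ (Y < p ^ N.+1)%N,
  padic_floor p w b = Y%:R / p%:R ^+ N & w (b - padic_floor p w b) < 1].
Proof.
have [y ey [N [a [ap bcvg yE]]]] : exists2 y, padic_floor p w b = y &
  exists (N : nat) (a : nat -> nat),
    [/\ forall k, (a k < p)%N,
        (fun n => (\sum_(k < n) (a k)%:R * p%:R ^ (k%:Z - N%:Z))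
           : metric_of w) @ \oo --> (b : metric_of w)
      & y = \sum_(k < N.+1) (a k)%:R * p%:R ^ (k%:Z - N%:Z)].
  have [N [a [ap bcvg]]] := padic_expansion b.
  exists (padic_floor p w b) => //.
  rewrite /padic_floor; set S := (S in xget _ S).
  by apply: (xgetPex 0 (P := S)); eexists; exists N, a; split.
rewrite ey; exists N, (\sum_(k < N.+1) a k * p ^ k)%N; split.
- exact: digits_lt.
- rewrite yE natr_sum mulr_suml; apply: eq_bigr => k _.
  by rewrite expfzDr// -exprnP -exprnN mulrA natrM natrX.
have /cvg_ballP/(_ 1 ltr01) bnear := bcvg.
have [M _ MP] := bnear.
(* This partial sum is within distance 1 of [b] and contains all terms of the floor; its other terms
   have positive exponent and absolute value below 1. *)
have {MP} := MP (M + N.+1)%N (leq_addr _ _); rewrite /= ball_metric_of => bM.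
apply: (ultra_trans wU bM).
rewrite yE -!(big_mkord xpredT (fun k => (a k)%:R * p%:R ^ (k%:Z - N%:Z))).
rewrite (big_cat_nat (n := N.+1)) ?leq_addl//= addrAC subrr add0r big_nat.
apply: ultra_sum => // k /andP[Nk _]; rewrite absvalM wpz opprB.
apply: (@le_lt_trans _ _ (1 * p%:R ^ (N%:Z - k%:Z))).
  apply: ler_wpM2r; first by rewrite exprz_ge0// ltW.
  exact: (padic_nat_le1 hp hw).
by rewrite mul1r -(expr0z (p%:R : R)) ltr_eXz2l//; lia.
Qed.

Lemma padic_floorB_lt1 b : w (b - padic_floor p w b) < 1.
Proof. by have [N [Y []]] := padic_floor_spec b. Qed.

Lemma padic_floor_nat b :
  exists c : nat * nat, padic_floor p w b = c.2%:R / p%:R ^+ c.1.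
Proof. by have [N [Y [_ -> _]]] := padic_floor_spec b; exists (N, Y). Qed.

(** Over the common denominator [p ^+ (N + M)] the two floors differ by an integer numerator that is
    divisible by [p ^ (N + M).+1] but smaller than it in size, hence zero. *)
Lemma padic_floor_eq b c : w (b - c) < 1 -> padic_floor p w b = padic_floor p w c.
Proof.
move=> bc.
have [N [Y [YN yE by_]]] := padic_floor_spec b.
have [M [Z [ZM zE cz]]] := padic_floor_spec c.
have : w (padic_floor p w b - padic_floor p w c) < 1.
  apply: (ultra_trans wU _ cz); apply: (ultra_trans wU _ bc).
  by rewrite absvalB.
rewrite yE zE; set x := (x in w x).
have pk k : p%:R ^+ k != 0 :> Q by rewrite expf_neq0.
have xE : x = ((Y * p ^ M)%N%:Z - (Z * p ^ N)%N%:Z)%:~R / p%:R ^+ (N + M).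
  rewrite /x intrB -!pmulrn !natrM !natrX exprD mulrBl; congr (_ - _).
    by rewrite -mulf_div divff// mulr1.
  by rewrite [_ ^+ N * _]mulrC -mulf_div divff// mulr1.
set z := (_ - _ : int) in xE.
have [z0|z0] := eqVneq z 0.
  by move=> _; apply/eqP; rewrite -subr_eq0 -/x xE z0 mul0r.
rewrite xE absvalM absvalV absvalX (padic_p hp hw) padic_int_abs//.
rewrite (padic_nat hw) ?absz_gt0// exprVn invrK ltr_pdivrMl ?exprn_gt0// mulr1.
rewrite ltr_eXn2l// -pfactor_dvdn ?absz_gt0// => /dvdn_leq.
rewrite absz_gt0 z0 => /(_ isT).
have : (Y * p ^ M < p ^ (N + M).+1)%N.
  by rewrite -addSn expnD ltn_pmul2r ?expn_gt0 ?prime_gt0.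
have : (Z * p ^ N < p ^ (N + M).+1)%N.
  by rewrite addnC -addSn expnD ltn_pmul2r ?expn_gt0 ?prime_gt0.
rewrite /z; lia.
Qed.
End PadicFloor.

(** * The basis of K over Qp and the floor function *)

Section LocalFieldExtension.
Context (R : realType) (p : nat) (hp : prime p) (Q : fieldType).
Context (w : absolute_value R Q) (hw : is_padic p w).
Context (K : fieldExtType Q) (v : absolute_value R K).
Context (hv : forall x : Q, v x%:A = w x).
Context (e f : nat) (he : ramification_index v fullv e).
Context (hf : residue_degree v fullv f).
Context (gamma : K) (hgamma : (p ^ f - 1)%N.-primitive_root gamma).
Context (beta : K) (hbeta : v beta = p%:R `^ (e%:R)^-1).

Let wU := padic_ultrametric hp hw.
Let p_gt0 : 0 < p%:R :> R. Proof. by rewrite ltr0n prime_gt0. Qed.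
Let p_gt1 : 1 < p%:R :> R. Proof. by rewrite ltr1n prime_gt1. Qed.

Lemma ext_absvalZ a x : v (a *: x) = w a * v x.
Proof. by rewrite -mulr_algl absvalM hv. Qed.

Lemma ext_nat n : v n%:R = w n%:R.
Proof. by rewrite -hv scaler_nat. Qed.

Lemma ext_int (z : int) : v z%:~R = w z%:~R.
Proof. by rewrite -hv scaler_int. Qed.

Lemma ext_ultrametric : ultrametric v.
Proof. by apply: ultrametric_of_nat => n; rewrite ext_nat (padic_nat_le1 hp hw). Qed.
Let vU := ext_ultrametric.

(** This value exceeds 1: [beta] acts as the inverse of a uniformizer, so small elements are
    measured by powers of [pi^-1]. *)
Let pi := v beta.

Let e_gt0 : (0 < e)%N.
Proof.
have [t [_ /(_ 1 (memvf _) (oner_neq0 _))[i _]]] := he.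
by case: e i => [[]|].
Qed.

Let pi_ge0 : 0 <= pi. Proof. exact: absval_ge0. Qed.

Lemma absval_beta_expe : pi ^+ e = p%:R.
Proof.
rewrite /pi hbeta -powR_mulrn ?powR_ge0// -powRrM mulVf ?powRr1// ?ltW//.
by rewrite pnatr_eq0 -lt0n.
Qed.

Lemma absval_beta_gt1 : 1 < pi.
Proof.
rewrite ltNge; apply/negP => pi1; have := exprn_ile1 e pi_ge0 pi1.
by rewrite absval_beta_expe leNgt p_gt1.
Qed.
Let pi_gt1 := absval_beta_gt1.
Let pi_gt0 : 0 < pi. Proof. exact: lt_trans ltr01 pi_gt1. Qed.

Let wE x : x != 0 -> exists n : int, w x = pi ^ (e%:Z * n).
Proof.
move=> /(padic_val hp hw)[n ->]; exists n.
by rewrite -exprz_exp -exprnP absval_beta_expe.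
Qed.

Let pi_inj (a b : int) : pi ^ a = pi ^ b -> a = b.
Proof.
move=> ab; apply/le_anti.
by rewrite -!(ler_eXz2l pi_gt1) ab lexx.
Qed.

Let pi_coset_inj (i j : 'I_e) (a b : int) :
  pi ^ (e%:Z * a) * pi ^+ i = pi ^ (e%:Z * b) * pi ^+ j -> i = j.
Proof.
rewrite ![pi ^+ _]exprnP -!expfzDr ?gt_eqF// => /pi_inj ab.
apply/val_inj; case: i j ab => [i ie] [j je] /= ab.
have [ltab|ltba|eqab] := ltgtP a b; [nia|nia|].
by rewrite eqab in ab; lia.
Qed.

(** Since [p = pi ^+ e], the values [pi ^+ i] with [i < e] lie in distinct cosets of the value group
    of [Q]. There are [e] cosets, so the map sending [i] to the representative of its coset is a
    bijection of ['I_e]. *)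
Lemma ext_value x : x != 0 ->
  exists (q : Q) (i : 'I_e), q != 0 /\ v x = w q * pi ^+ i.
Proof.
have [t [tE tex]] := he.
have beta0 : beta != 0 by rewrite -(absval_gt0 v).
have /fin_all_exists[s sP] (i : 'I_e) : exists j : 'I_e,
    exists2 q : Q, q != 0 & pi ^+ i = w q * v (t j).
  have [|j [[q q0 qE] _]] := tex (beta ^+ i) (memvf _).
    by rewrite expf_neq0.
  by exists j, q => //; rewrite -absvalX qE hv.
have s_inj : injective s.
  move=> i j sij; have [q q0 iE] := sP i; have [q' q'0 jE] := sP j.
  have [a qa] := wE q0; have [b q'b] := wE q'0.
  have ts0 : v (t (s i)) != 0 by rewrite gt_eqF// absval_gt0; case: (tE (s i)).
  apply: (@pi_coset_inj _ _ b a); rewrite iE jE -sij -qa -q'b; ring.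
have [s' s'K ss'] := injF_bij s_inj.
move=> x0; have [i [[q q0 qE] _]] := tex x (memvf _) x0.
have [q' q'0 q'E] := sP (s' i); rewrite ss' in q'E.
exists (q / q'), (s' i); split; first by rewrite mulf_neq0// invr_neq0.
by rewrite qE hv absvalM absvalV q'E mulrA divfK// gt_eqF// absval_gt0.
Qed.

Lemma ext_lt1 x : v x < 1 -> v x <= pi^-1.
Proof.
have [->|/ext_value[q [i [/wE[n ->] ->]]]] := eqVneq x 0.
  by rewrite absval0 invr_ge0.
rewrite exprnP -expfzDr ?gt_eqF// -[X in _ < X -> _](expr0z pi) ltr_eXz2l// => n0.
by rewrite -[leRHS]expr1z exprz_inv ler_eXz2l//; lia.
Qed.

(** * The residues of the powers of [gamma] *)

Let n0 := (p ^ f - 1)%N.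
Let n0_gt0 : (0 < n0)%N. Proof. exact: prim_order_gt0 hgamma. Qed.

Let v_gamma : v gamma = 1.
Proof.
have /(congr1 v) := prim_expr_order hgamma; rewrite absvalX absval1 => /eqP.
by rewrite pexpr_eq1 ?absval_ge0// => /eqP.
Qed.

Let v_gammaX k : v (gamma ^+ k) = 1. Proof. by rewrite absvalX v_gamma expr1n. Qed.

Let p_ndvd_n0 : ~~ (p %| n0)%N.
Proof.
have f0 : (0 < f)%N by move: n0_gt0; rewrite /n0; case: f => //; rewrite expn0.
apply/negP => pn; have : (p %| 1)%N.
  by rewrite -(dvdn_addr 1 pn) subnK ?expn_gt0 ?prime_gt0// dvdn_exp.
by rewrite dvdn1 => /eqP p1; move: (prime_gt1 hp); rewrite p1.
Qed.

(* If g = gamma ^+ (j - i) != 1 were congruent to 1, then 1 + g + ... + g ^+ (n0 - 1),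
   which vanishes, would be congruent to n0, a unit. *)
Let gamma_incongruent (i j : nat) : (i < j < n0)%N ->
  1 <= v (gamma ^+ i - gamma ^+ j).
Proof.
move=> /andP[ij jn]; rewrite leNgt; apply/negP => vij.
set g := gamma ^+ (j - i).
have vg1 : v (g - 1) < 1.
  rewrite absvalB; move: vij; rewrite -(subnK (ltnW ij)) exprD -/g.
  by rewrite -{1}[gamma ^+ i]mul1r -mulrBl absvalM v_gammaX mulr1.
have g1 : g != 1.
  rewrite -(expr0 gamma) (eq_prim_root_expr hgamma) mod0n modn_small.
    by rewrite subn_eq0 -ltnNge.
  by rewrite (leq_ltn_trans (leq_subr _ _)).
have gn : g ^+ n0 = 1 by rewrite exprAC (prim_expr_order hgamma) expr1n.
have := subrX1 g n0; rewrite gn subrr => /esym/eqP.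
rewrite mulf_eq0 subr_eq0 (negbTE g1)/= => /eqP S0.
have : v (\sum_(k < n0) g ^+ k - n0%:R) < 1.
  rewrite -[n0 in n0%:R]card_ord -sumr_const -sumrB; apply: ultra_sum => // k _.
  rewrite subrX1 absvalM; apply: le_lt_trans vg1.
  rewrite ler_piMr ?absval_ge0//; apply: ultra_sum_le => // l _.
  by rewrite -exprM v_gammaX.
rewrite S0 sub0r absvalN ext_nat (padic_nat_lt1 hp hw).
by rewrite (negbTE p_ndvd_n0).
Qed.

Let ev (P : {poly int}) : K := (map_poly intr P).[gamma].

Let v_int_le1 (z : int) : v z%:~R <= 1.
Proof. by rewrite ext_int (padic_int_le1 hp hw). Qed.

Let v_ev P : v (ev P) <= 1.
Proof.
rewrite /ev horner_coef; apply: ultra_sum_le => // i _.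
by rewrite absvalM v_gammaX mulr1 coef_map v_int_le1.
Qed.

Let redp (z : int) : 'I_p.
Proof.
apply: (@Ordinal p `|(z %% p)%Z|%N).
by rewrite -ltz_nat gez0_abs ?modz_ge0 ?ltz_pmod ?ltz_nat ?prime_gt0// -lt0n prime_gt0.
Defined.

Let redpP z : v (z%:~R - (redp z)%:R) < 1.
Proof.
rewrite pmulrn -intrB ext_int (padic_int_lt1 hp hw)/= gez0_abs.
  by rewrite {1}(divz_eq z p) addrK dvdz_mull.
by rewrite modz_ge0// -lt0n prime_gt0.
Qed.

(* A monic relation of degree n among the residues of the powers of gamma
   leaves at most p ^ n residues for the p ^ f elements 0, gamma ^+ k. *)
Let gamma_degree (D : {poly int}) n : D \is monic -> size D = n.+1 ->
  v (ev D) < 1 -> (f <= n)%N.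
Proof.
move=> Dmonic szD evD.
(* Dividing ['X^k] by the monic [D] leaves a remainder of degree below [n], whose coefficients are
   then reduced modulo [p]. *)
have red k : exists c : {ffun 'I_n -> 'I_p},
    v (gamma ^+ k - \sum_(j < n) (c j)%:R * gamma ^+ j) < 1.
  pose r := Pdiv.Ring.rmodp 'X^k D.
  have szr : (size r <= n)%N.
    by rewrite -ltnS -szD Pdiv.Ring.ltn_rmodp monic_neq0.
  exists [ffun j : 'I_n => redp r`_j].
  have -> : gamma ^+ k = ev (Pdiv.Ring.rdivp 'X^k D) * ev D + ev r.
    have := congr1 ev (Pdiv.RingMonic.rdivp_eq Dmonic 'X^k).
    by rewrite /ev rmorphD rmorphM hornerD hornerM map_polyXn hornerXn.
  rewrite -addrA; apply: ultraD => //.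
    rewrite absvalM; apply: le_lt_trans evD.
    by rewrite ler_piMl ?absval_ge0.
  rewrite /ev (horner_coef_wide _ (n := n)); last first.
    by apply: leq_trans szr; exact: size_poly.
  rewrite -sumrB; apply: ultra_sum => // j _.
  by rewrite ffunE coef_map -mulrBl absvalM v_gammaX mulr1 redpP.
have [c cP] := choice red.
(* [None] stands for the element 0, which brings the number of incongruent elements from [p ^ f - 1]
   to [p ^ f]. *)
pose E (k : option 'I_n0) : K := if k is Some k then gamma ^+ k else 0.
pose C (k : option 'I_n0) : {ffun 'I_n -> 'I_p} :=
  if k is Some k then c k else [ffun j => redp 0].
have redp0 : redp 0 = 0%N :> nat by rewrite /= mod0z.
have CP k : v (E k - \sum_(j < n) (C k j)%:R * gamma ^+ j) < 1.
  case: k => [k|] /=; first exact: cP.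
  rewrite big1 ?subrr ?absval0// => j _.
  by rewrite ffunE redp0 mul0r.
have Einj k l : v (E k - E l) < 1 -> k = l.
  case: k l => [k|] [l|]//=; rewrite ?subr0 ?sub0r ?absvalN ?v_gammaX ?ltxx//.
  have [kl|lk|/val_inj ->//] := ltngtP k l.
    by rewrite ltNge gamma_incongruent// kl/=.
  by rewrite absvalB ltNge gamma_incongruent// lk/=.
have Cinj : injective C.
  move=> k l kl; apply: Einj; apply: (ultra_trans vU (CP k)).
  by rewrite absvalB kl.
have := leq_card _ Cinj; rewrite card_option card_ffun !card_ord.
rewrite /n0 subn1 prednK ?expn_gt0 ?prime_gt0//.
by rewrite leq_exp2l// prime_gt1.
Qed.

(** Induction on [n]: if the top coefficient were prime to [p], a Bezout multiplier would turn the
    relation into a monic one of degree less than [f], against [gamma_degree]. *)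
Let gamma_indep (c : nat -> int) n : (n <= f)%N ->
  v (\sum_(j < n) (c j)%:~R * gamma ^+ j) < 1 ->
  forall j, (j < n)%N -> (p %| c j)%Z.
Proof.
elim: n => // n IH nf; rewrite big_ord_recr/= => S1.
have [pc|pc] := boolP (p %| c n)%Z.
  move=> j; rewrite ltnS leq_eqVlt => /orP[/eqP->//|jn].
  apply: IH jn; first exact: ltnW.
  rewrite -[X in v X](addrK ((c n)%:~R * gamma ^+ n)); apply: ultraB => //.
  by rewrite absvalM v_gammaX mulr1 ext_int (padic_int_lt1 hp hw).
have /coprimezP[[u t] /= ut] : coprimez (c n) p.
  by rewrite coprimez_sym /coprimez -[_ == _]/(coprime p `|c n|) prime_coprime.
pose D : {poly int} := 'X^n + \poly_(j < n) (u * c j).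
have szD : size D = n.+1.
  by rewrite size_polyDl size_polyXn// ltnS size_poly.
suff : (f <= n)%N by rewrite leqNgt nf.
apply: (gamma_degree _ szD).
  rewrite monicE lead_coefDl ?lead_coefXn//.
  by rewrite size_polyXn ltnS size_poly.
have -> : ev D = u%:~R * (\sum_(j < n) (c j)%:~R * gamma ^+ j + (c n)%:~R * gamma ^+ n)
    + (t * p%:Z)%:~R * gamma ^+ n.
  rewrite mulrDr -addrA mulrA -mulrDl -!intrM -intrD ut mul1r addrC.
  rewrite /ev rmorphD/= map_polyXn hornerD hornerXn; congr (_ + _).
  rewrite (horner_coef_wide _ (n := n)).
    rewrite mulr_sumr; apply: eq_bigr => j _.
    by rewrite coef_map coef_poly ltn_ord/= intrM mulrA.
  by apply: leq_trans (size_poly _ _); exact: size_poly.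
apply: ultraD => //.
  by rewrite absvalM; apply: le_lt_trans S1; rewrite ler_piMl ?absval_ge0.
by rewrite absvalM v_gammaX mulr1 ext_int (padic_int_lt1 hp hw) dvdz_mull.
Qed.

Let f_gt0 : (0 < f)%N.
Proof. by move: n0_gt0; rewrite /n0; case: f => //; rewrite expn0. Qed.

(** Combinations with digits below [p] of the [t j] represent all residues. Sending a combination of
    powers of [gamma] to a congruent one of the [t j] is injective by [gamma_indep], hence bijective
    because both families are indexed by the same finite set. *)
Lemma ext_residue x : v x <= 1 ->
  exists c : 'I_f -> nat, v (x - \sum_(j < f) (c j)%:R * gamma ^+ j) < 1.
Proof.
have [t [tE tgen _]] := hf.
have tcl y : v y <= 1 -> exists c : {ffun 'I_f -> 'I_p},
    v (y - \sum_(j < f) (c j)%:R * t j) < 1.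
  move=> y1; have [c c1 yc] := tgen y (memvf _) y1.
  have /fin_all_exists[d dP] (j : 'I_f) : exists d : 'I_p, w (c j - d%:R) < 1.
    have [|d dp cd] := padic_digit hp hw (x := c j); first by rewrite -hv.
    by exists (Ordinal dp).
  exists (finfun d); apply: (ultra_trans vU yc); rewrite -sumrB.
  apply: ultra_sum => // j _; rewrite ffunE mulr_natl -scaler_nat -scalerBl ext_absvalZ.
  apply: le_lt_trans (dP j); rewrite ler_piMr ?absval_ge0//.
  by case: (tE j).
have /fin_all_exists[h hP] (g : {ffun 'I_f -> 'I_p}) :
    exists d : {ffun 'I_f -> 'I_p},
    v (\sum_(j < f) (g j)%:R * gamma ^+ j - \sum_(j < f) (d j)%:R * t j) < 1.
  apply: tcl; apply: ultra_sum_le => // j _.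
  by rewrite absvalM v_gammaX mulr1 ext_nat (padic_nat_le1 hp hw).
have h_inj : injective h.
  move=> g g' hgg; apply/ffunP => j; apply/val_inj/eqP.
  (* The coefficients are extended by 0 beyond [f], to fit the sequences indexed by [nat] in
     [gamma_indep]. *)
  pose c k : int := if insub k is Some j then (g j)%:Z - (g' j)%:Z else 0.
  have cE (k : 'I_f) : c k = (g k)%:Z - (g' k)%:Z by rewrite /c valK.
  have : v (\sum_(j < f) (c j)%:~R * gamma ^+ j) < 1.
    have -> : \sum_(j < f) (c j)%:~R * gamma ^+ j =
      \sum_(j < f) (g j)%:R * gamma ^+ j - \sum_(j < f) (g' j)%:R * gamma ^+ j.
      rewrite -sumrB; apply: eq_bigr => k _.
      by rewrite cE intrB mulrBl.
    apply: (ultra_trans vU (hP g)); rewrite hgg absvalB; exact: hP.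
  move=> /(gamma_indep (leqnn f))/(_ j (ltn_ord j)); rewrite cE => /dvdzP[q].
  rewrite /=; move: (ltn_ord (g j)) (ltn_ord (g' j)).
  move: (nat_of_ord (g j)) (nat_of_ord (g' j)) => y z yp zp yz.
  have [q0|q0|q0] := ltgtP q 0; [nia|nia|].
  by rewrite q0 mul0r in yz; apply/eqP; lia.
have [h' h'K hh'] := injF_bij h_inj.
move=> /tcl[d xd]; exists (fun j => h' d j : nat).
by apply: (ultra_trans vU xd); rewrite absvalB -{2}(hh' d).
Qed.

(** Divide by a coefficient of largest absolute value. If the sum were smaller than that maximum,
    the digits of the quotients, one of them congruent to 1, would give a relation excluded by
    [gamma_indep]. *)
Let row_value (b : 'I_f -> Q) : exists k, (forall j, w (b j) <= w (b k)) /\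
  v (\sum_(j < f) b j *: gamma ^+ j) = w (b k).
Proof.
pose k := [arg max_(j > Ordinal f_gt0) w (b j)]%O; exists k.
have kP j : w (b j) <= w (b k).
  by rewrite /k; case: Order.TotalTheory.arg_maxP => // l _; apply.
split=> //; apply/le_anti/andP; split.
  apply: ultra_sum_le => // [|j _]; first exact: absval_ge0.
  by rewrite ext_absvalZ v_gammaX mulr1.
have [->|bk0] := eqVneq (b k) 0; first by rewrite absval0 absval_ge0.
have wk0 : 0 < w (b k) by rewrite absval_gt0.
rewrite leNgt; apply/negP => ltk.
have /fin_all_exists[d dP] (j : 'I_f) : exists d : nat, w (b j / b k - d%:R) < 1.
  have [|d _] := padic_digit hp hw (x := b j / b k); last by exists d.
  by rewrite absvalM absvalV ler_pdivrMr// mul1r.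
pose c j : int := if insub j is Some j then (d j)%:Z else 0.
have cE (j : 'I_f) : c j = (d j)%:Z by rewrite /c valK.
have : v (\sum_(j < f) (c j)%:~R * gamma ^+ j) < 1.
  have S1 : v (\sum_(j < f) (b j / b k) *: gamma ^+ j) < 1.
    have -> : \sum_(j < f) (b j / b k) *: gamma ^+ j =
        (b k)^-1 *: \sum_(j < f) b j *: gamma ^+ j.
      by rewrite scaler_sumr; apply: eq_bigr => j _; rewrite scalerA mulrC.
    by rewrite ext_absvalZ absvalV ltr_pdivrMl// mulr1.
  rewrite -[X in v X](addrK (\sum_(j < f) (b j / b k) *: gamma ^+ j)) -addrA.
  rewrite addrCA; apply: ultraD => //; rewrite -sumrB; apply: ultra_sum => // j _.
  rewrite cE (_ : (d j)%:~R * _ = (d j)%:R *: gamma ^+ j); last first.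
    by rewrite scaler_nat mulr_natl.
  by rewrite -scalerBl ext_absvalZ v_gammaX mulr1 absvalB.
move=> /(gamma_indep (leqnn f))/(_ k (ltn_ord k)); rewrite cE dvdzE/= => pd.
have := dP k; rewrite divff// -(padic_nat_lt1 hp hw) in pd *.
by move=> d1; have := ultraD wU d1 pd; rewrite subrK absval1 ltxx.
Qed.

(** * Coordinates in the basis [gamma ^+ j * beta ^+ i] *)

Local Notation fc := (from_coeffs gamma beta).

Let fcE (b : 'M[Q]_(e, f)) :
  fc b = \sum_(i < e) beta ^+ i * \sum_(j < f) b i j *: gamma ^+ j.
Proof.
apply: eq_bigr => i _; rewrite mulr_sumr; apply: eq_bigr => j _.
by rewrite -scalerAr mulrC.
Qed.

Let fcB (b c : 'M[Q]_(e, f)) : fc (b - c) = fc b - fc c.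
Proof.
rewrite /from_coeffs -sumrB; apply: eq_bigr => i _.
by rewrite -sumrB; apply: eq_bigr => j _; rewrite !mxE scalerBl.
Qed.

(** By [row_value] row [i] has its value in the coset of [pi ^+ i], so nonzero rows have distinct
    absolute values and none exceeds that of the sum. *)
Let fc_ge (b : 'M[Q]_(e, f)) i j : w (b i j) * pi ^+ i <= v (fc b).
Proof.
pose F (i : 'I_e) := beta ^+ i * \sum_(j < f) b i j *: gamma ^+ j.
have FE l : exists k, (forall j, w (b l j) <= w (b l k)) /\
    v (F l) = pi ^+ l * w (b l k).
  have [k [kmax kE]] := row_value (b l).
  by exists k; split=> //; rewrite /F absvalM absvalX kE.
have Fd l k : F l != 0 -> l != k -> v (F l) != v (F k).
  move=> Fl0; apply: contra_neq => lk.
  have [l' [_ lE]] := FE l; have [k' [_ kE]] := FE k.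
  have : v (F k) != 0 by rewrite -lk gt_eqF// absval_gt0.
  have : v (F l) != 0 by rewrite gt_eqF// absval_gt0.
  rewrite lE kE !mulf_eq0 !negb_or => /andP[_ bl] /andP[_ bk].
  have wb0 c : w c != 0 -> c != 0 by apply: contra_neq => ->; rewrite absval0.
  have [x xE] := wE (wb0 _ bl); have [y yE] := wE (wb0 _ bk).
  apply: (@pi_coset_inj l k x y); rewrite -xE -yE mulrC -lE lk kE; exact: mulrC.
rewrite fcE; apply: le_trans (ultra_sum_distinct vU Fd i).
have [k [kmax ->]] := FE i.
by rewrite mulrC ler_pM2l ?exprn_gt0.
Qed.

Let fc_le (b : 'M[Q]_(e, f)) r : 0 <= r ->
  (forall i j, w (b i j) <= r) -> v (fc b) <= r * pi ^+ e.-1.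
Proof.
move=> r0 br; apply: (ultra_sum_le vU) => [|i _]; first by rewrite mulr_ge0 ?exprn_ge0.
apply: (ultra_sum_le vU) => [|j _]; first by rewrite mulr_ge0 ?exprn_ge0.
rewrite ext_absvalZ absvalM v_gammaX mul1r absvalX.
apply: ler_pM => //; rewrite ?absval_ge0 ?exprn_ge0//.
by rewrite ler_eXn2l// -ltnS prednK.
Qed.

(** A coordinate below 1 is at most [p^-1], that is [pi ^- e], and the factor [pi ^+ e.-1] of
    [fc_le] cannot raise this to 1. *)
Lemma from_coeffs_lt1 (b : 'M[Q]_(e, f)) :
  v (fc b) < 1 <-> forall i j, w (b i j) < 1.
Proof.
split=> [b1 i j|b1].
  apply: le_lt_trans b1; apply: le_trans (fc_ge b i j).
  by rewrite ler_peMr ?absval_ge0// exprn_ege1// ltW.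
have p0 : 0 <= p%:R^-1 :> R by rewrite invr_ge0 ltW.
apply: (le_lt_trans (fc_le p0 _)).
  by move=> i j; apply: (padic_lt1 hp hw).
rewrite ltr_pdivrMl// mulr1 -absval_beta_expe -[in ltRHS](prednK e_gt0).
by rewrite ltr_eXn2l.
Qed.

Lemma from_coeffs_inj (b c : 'M[Q]_(e, f)) : fc b = fc c -> b = c.
Proof.
move=> /eqP; rewrite -subr_eq0 -fcB => /eqP bc.
apply/matrixP => i j; apply/eqP; rewrite -subr_eq0 -[_ == _]negbK.
rewrite -(absval_gt0 w) -leNgt; have := fc_ge (b - c) i j.
by rewrite bc absval0 !mxE pmulr_lle0// exprn_gt0.
Qed.

Let padic_limit (u : nat -> Q) C t : 0 <= C -> 0 <= t < 1 ->
  (forall m n, (m <= n)%N -> w (u n - u m) <= C * t ^+ m) ->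
  exists l, forall n, w (l - u n) <= C * t ^+ n.
Proof.
move=> C0 /andP[t0 t1] uC.
have tm m n : (m <= n)%N -> C * t ^+ n <= C * t ^+ m.
  by move=> mn; rewrite ler_wpM2l// ler_wiXn2l// ltW.
have /(padic_complete hw) : cauchy ((u : nat -> metric_of w) @ \oo).
  apply/cauchy_ballP => eps eps0.
  have [M _ MP] := near_geometric_lt C t0 t1 eps0.
  pose S : set (metric_of w) := [set u n | n in [set n | (M <= n)%N]].
  exists (S, S); first by split; exists M => // n Mn; exists n.
  move=> [_ _] /= [[m Mm <-] [n Mn <-]]; rewrite ball_metric_of.
  have := MP M (leqnn _); apply: le_lt_trans.
  have [mn|/ltnW nm] := leqP m n; first rewrite absvalB.
    by apply: le_trans (uC _ _ mn) _; exact: tm.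
  by apply: le_trans (uC _ _ nm) _; exact: tm.
move=> /cvg_ex[l /cvg_ballP ul]; exists l => n.
apply/ler_addgt0Pr => eps eps0.
have [M _ MP] := ul _ eps0.
have := MP (M + n)%N (leq_addr _ _); rewrite /= ball_metric_of => lM.
have := uC n (M + n)%N (leq_addl _ _) => uM.
have -> : l - u n = (l - u (M + n)%N) + (u (M + n)%N - u n) by rewrite addrA subrK.
apply: le_trans (absval_triangle _ _ _) _; rewrite addrC; apply: lerD => //.
exact: ltW.
Qed.

(** Choose [y = q *: beta ^+ i] with [v y = v x]; the unit [x / y] is congruent to a combination of
    powers of [gamma], and multiplying back by [y] fills the single row [i]. *)
Let approx_step x : exists b : 'M[Q]_(e, f),
  v (x - fc b) <= pi^-1 * v x /\ forall i j, w (b i j) <= v x.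
Proof.
have [->|x0] := eqVneq x 0.
  exists 0; rewrite (_ : fc 0 = 0).
    by rewrite subrr absval0 mulr0; split=> // i j; rewrite mxE absval0.
  by rewrite -(subrr 0) fcB subrr.
have [q [i [q0 xE]]] := ext_value x0.
pose y := q *: beta ^+ i.
have vy : v y = v x by rewrite ext_absvalZ absvalX xE.
have y0 : y != 0 by rewrite -(absval_gt0 v) vy absval_gt0.
have [|c /ext_lt1 xc] := @ext_residue (x / y).
  by rewrite absvalM absvalV vy divff// gt_eqF// absval_gt0.
exists (\matrix_(k, j) if k == i then q * (c j)%:R else 0); split; last first.
  move=> k j; rewrite mxE; case: ifP => _; last by rewrite absval0 absval_ge0.
  rewrite absvalM xE ler_wpM2l ?absval_ge0//.
  apply: (le_trans (padic_nat_le1 hp hw _)).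
  by rewrite exprn_ege1// ltW.
rewrite -[in leRHS]vy -ler_pdivrMr ?absval_gt0// -absvalV -absvalM.
apply: le_trans xc; rewrite le_eqVlt; apply/orP; left; apply/eqP; congr (v _).
rewrite mulrBl; congr (_ - _).
rewrite fcE (bigD1 i)//= [X in _ + X]big1 ?addr0; last first.
  move=> k /negbTE ki; rewrite big1 ?mulr0// => j _.
  by rewrite mxE ki scale0r.
apply: (mulIf y0); rewrite divfK// mulr_suml mulr_sumr.
apply: eq_bigr => j _; rewrite mxE eqxx -scalerA scaler_nat -mulr_natl.
by rewrite /y -!scalerAr mulr1 mulr_natl mulrC.
Qed.

(* Successive approximation: approx_step shrinks the remainder by a constant
   factor, and completeness of Q sums the corrections coefficientwise. *)
Lemma from_coeffs_surj x : exists b : 'M[Q]_(e, f), x = fc b.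
Proof.
have [s sP] := choice approx_step.
pose X n := iter n (fun y => y - fc (s y)) x.
pose B n := \sum_(k < n) s (X k).
have pi1 : 0 <= pi^-1 < 1 by rewrite invr_ge0 pi_ge0 invf_lt1.
have /andP[pi10 pi11] := pi1.
have vX n : v (X n) <= v x * pi^-1 ^+ n.
  elim: n => [|n IH]; first by rewrite mulr1.
  have [h _] := sP (X n); apply: le_trans h _.
  by rewrite exprS mulrCA ler_wpM2l.
have XB n : X n = x - fc (B n).
  elim: n => [|n IH].
    by rewrite /B big_ord0 -(subrr 0) fcB subrr subr0.
  rewrite /= {1}IH /B big_ord_recr/= -(opprK (s _)) fcB.
  rewrite -/(B n) (_ : fc (- s (X n)) = - fc (s (X n))) ?opprK ?opprD ?addrA//.
  by rewrite -sub0r fcB -(subrr 0) fcB subrr sub0r.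
have Blim i j : exists l, forall n, w (l - B n i j) <= v x * pi^-1 ^+ n.
  apply: padic_limit => // [|m n mn]; first exact: absval_ge0.
  have -> : B n i j - B m i j = \sum_(m <= k < n) s (X k) i j.
    rewrite /B !summxE -!(big_mkord xpredT (fun k => s (X k) i j)).
    by rewrite (big_cat_nat (n := m))//= addrAC subrr add0r.
  rewrite big_nat; apply: ultra_sum_le => // [|k /andP[mk _]].
    by rewrite mulr_ge0 ?absval_ge0// exprn_ge0.
  have [_ h] := sP (X k); apply: le_trans (h i j) _; apply: le_trans (vX k) _.
  by rewrite ler_wpM2l ?absval_ge0// ler_wiXn2l// ltW.
have /fin_all_exists[L LP] i : exists L : 'I_f -> Q,
    forall j n, w (L j - B n i j) <= v x * pi^-1 ^+ n.
  exact: (fin_all_exists (Blim i)).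
pose b : 'M[Q]_(e, f) := \matrix_(i, j) L i j.
exists b; apply/eqP; rewrite -subr_eq0 -[_ == _]negbK -(absval_gt0 v).
apply/negP => xb0.
have C0 : 0 <= pi ^+ e.-1 by rewrite exprn_ge0.
have [N _ /(_ N (leqnn _))/=] :=
  near_geometric_lt (v x * pi ^+ e.-1) pi10 pi11 xb0.
rewrite ltNge => /negP; apply.
have tN : 0 <= pi^-1 ^+ N by rewrite exprn_ge0.
have e1 : 1 <= pi ^+ e.-1 by rewrite exprn_ege1// ltW.
have -> : x - fc b = X N - fc (b - B N) by rewrite XB fcB opprB addrA subrK.
apply: ultraDle => //; rewrite ?absvalN mulrAC.
  by apply: le_trans (vX N) _; rewrite ler_peMr// mulr_ge0 ?absval_ge0.
apply: fc_le => [|i j]; first by rewrite mulr_ge0 ?absval_ge0.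
by rewrite !mxE LP.
Qed.

Lemma coeffsK (b : 'M[Q]_(e, f)) : coeffs e f gamma beta (fc b) = b.
Proof.
rewrite /coeffs; apply: xget_unique => // c /= bc.
exact/esym/from_coeffs_inj.
Qed.

(** * The floor function on [K] *)

Local Notation fl := (floor_part p w e f gamma beta).

Let flE (b : 'M[Q]_(e, f)) : fl (fc b) = fc (map_mx (padic_floor p w) b).
Proof. by rewrite /floor_part coeffsK. Qed.

Lemma floor_partB_lt1 x : v (x - fl x) < 1.
Proof.
have [b ->] := from_coeffs_surj x; rewrite flE -fcB.
by apply/from_coeffs_lt1 => i j; rewrite !mxE (padic_floorB_lt1 hp hw).
Qed.

Lemma floor_part_eq x y : v (x - y) < 1 -> fl x = fl y.
Proof.
have [b ->] := from_coeffs_surj x; have [c ->] := from_coeffs_surj y.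
rewrite -fcB !flE => /from_coeffs_lt1 bc; congr fc.
apply/matrixP => i j; rewrite !mxE (padic_floor_eq hp hw (c := c i j))//.
by have := bc i j; rewrite !mxE.
Qed.

(** The cosets of the open unit ball are countable, since floors are described by matrices of pairs
    of natural numbers. The code numbers partitions into balls by [nat]. *)
Lemma floor_part_code :
  exists code : K -> nat, forall x y, code x = code y <-> v (x - y) < 1.
Proof.
pose dec (m : 'M[nat * nat]_(e, f)) : K :=
  fc (map_mx (fun c => c.2%:R / p%:R ^+ c.1) m).
have /choice[h hP] x : exists m, fl x = dec m.
  have [b ->] := from_coeffs_surj x; rewrite flE.
  have /choice[g gP] (a : Q) := padic_floor_nat hp hw a.
  by exists (map_mx g b); congr fc; apply/matrixP => i j; rewrite !mxE.
(* Unlike [h], this choice depends on [fl x] alone, so congruent points receive the same code. *)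
pose g x := xget 0 [set m | fl x = dec m].
have gP x : fl x = dec (g x).
  by rewrite /g; apply: (xgetPex 0 (P := [set m | fl x = dec m])); exists (h x).
exists (fun x => choice.pickle (g x)) => x y; split=> [/(pcan_inj choice.pickleK) gxy|xy].
  apply: (ultra_trans vU (floor_partB_lt1 x)); rewrite gP gxy -gP absvalB.
  exact: floor_partB_lt1.
by rewrite /g (floor_part_eq xy).
Qed.
End LocalFieldExtension.

(** * Balls and invariant measures *)

Section Pushforward.
Context d d' (T1 : measurableType d) (T2 : measurableType d') (R : realType).
Context (m : {measure set T1 -> \bar R}) (f : T1 -> T2).
Context (mf : measurable_fun [set: T1] f).

Definition image_measure : {measure set T2 -> \bar R} :=
  measure_function_pushforward__canonical__measure_function_Measure m mf.
End Pushforward.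

Lemma ge0_integral_mrestr d (T : measurableType d) (R : realType)
    (m : {measure set T -> \bar R}) (D : set T) (mD : measurable D)
    (g : T -> \bar R) : measurable_fun setT g -> (forall x, 0 <= g x)%E ->
  (\int[mrestr m mD]_x g x = \int[m]_(x in D) g x)%E.
Proof.
move=> mg g0; have mDC := measurableC mD.
have D0 : mrestr m mD (~` D) = 0%E by rewrite /mrestr setICl measure0.
rewrite (ge0_negligible_integral mDC measurableT mg _ D0)//.
rewrite setTD setCK; apply: eq_measure_integral => A mA AD.
by rewrite /= /mrestr setIidl.
Qed.

Lemma measure_fibers d (T : measurableType d) (R : realType)
    (m : {measure set T -> \bar R}) (D : set T) (g : T -> nat) :
  (forall n, measurable (D `&` [set x | g x = n])) ->
  (m D = \sum_(n <oo) m (D `&` [set x | g x = n]))%E.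
Proof.
move=> mF; rewrite -[in LHS](setIT D).
have -> : [set: T] = \bigcup_n [set x | g x = n].
  by apply/seteqP; split=> // x _; exists (g x).
rewrite setI_bigcupr measure_semi_bigcup//; last exact: bigcup_measurable.
apply/trivIsetP => i j _ _ /eqP ij; apply/seteqP; split=> // x [[_ xi] [_ xj]].
by apply: ij; rewrite -xi.
Qed.

Section Ultrametric.
Context (R : realType) (K : fieldType) (v : absolute_value R K).
Context (vU : ultrametric v).
Local Notation B := (unit_ball v).
Local Notation borelK := (borel_of v).

Lemma metric_openP (A : set (metric_of v)) :
  open A <-> forall x : K, A x -> exists2 r, 0 < r & forall y, v (x - y) < r -> A y.
Proof.
rewrite openE; split=> [Ao x /Ao/nbhs_ballP[r r0 rA]|Ao x /Ao[r r0 rA]].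
  by exists r => // y xy; apply: rA.
by apply/nbhs_ballP; exists r.
Qed.

Lemma open_measurable_borel (A : set (metric_of v)) :
  open A -> measurable (A : set borelK).
Proof. exact: sub_sigma_algebra. Qed.

Definition open_ball (x : K) (r : R) : set borelK := [set y : K | v (x - y) < r].

Lemma open_ball_open x r : open (open_ball x r : set (metric_of v)).
Proof.
apply/metric_openP => y xy; exists r; last first.
  by move=> z yz; apply: (ultra_trans vU xy).
by apply: le_lt_trans xy; exact: absval_ge0.
Qed.

Lemma measurable_open_ball x r : measurable (open_ball x r).
Proof. by apply: open_measurable_borel; exact: open_ball_open. Qed.

Lemma unit_ballE : B = open_ball 0 1.
Proof. by apply/seteqP; split=> x; rewrite /unit_ball /open_ball/= sub0r absvalN. Qed.

Lemma measurable_unit_ball : measurable B.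
Proof. by rewrite unit_ballE; exact: measurable_open_ball. Qed.

Context (mu : {measure set borelK -> \bar R}).
Context (mu_translation : forall (x : K) (A : set borelK), measurable A ->
    mu ([set x + y | y in (A : set K)] : set borelK) = mu A).
Context (muB : mu B = 1%E).

Lemma mu_open_ball x y r : mu (open_ball x r) = mu (open_ball y r).
Proof.
rewrite -(mu_translation (x - y) (measurable_open_ball y r)); congr (mu _).
apply/seteqP; split=> [z xz|_ [z yz <-]]; rewrite /open_ball/=.
  exists (z - (x - y)); last by rewrite addrC subrK.
  rewrite /open_ball/=; have -> : y - (z - (x - y)) = x - z by ring.
  exact: xz.
by have -> : x - (x - y + z) = y - z by ring.
Qed.

Context (code : K -> nat) (codeP : forall x y, code x = code y <-> v (x - y) < 1).
Context (u : K) (u_gt0 : 0 < v u) (u_lt1 : v u < 1).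

(** For fixed [N] the nonempty ones are the balls of radius [v u ^+ N], numbered by [nat]. *)
Definition code_ball (N n : nat) : set borelK := [set y : K | code (u ^- N * y) = n].

Lemma code_ballE N n (x : K) : code_ball N n x -> code_ball N n = open_ball x (v u ^+ N).
Proof.
move=> <-; have uN : u ^+ N != 0 by rewrite expf_neq0// -(absval_gt0 v).
apply/seteqP; split=> y; rewrite /code_ball /open_ball/=.
  move=> /esym/codeP; rewrite -mulrBr absvalM absvalV absvalX.
  by rewrite ltr_pdivrMl ?exprn_gt0// mulr1.
move=> xy; apply/esym/codeP; rewrite -mulrBr absvalM absvalV absvalX.
by rewrite ltr_pdivrMl ?exprn_gt0// mulr1.
Qed.

Let code_ball_nested N M n m : (N <= M)%N ->
  code_ball M m `<=` code_ball N n \/ code_ball M m `&` code_ball N n = set0.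
Proof.
move=> NM; have [[z [zM zN]]|/set0P/negP] :=
    pselect (code_ball M m `&` code_ball N n !=set0); last first.
  by move/negbNE/eqP; right.
left; rewrite (code_ballE zM) (code_ballE zN) => y; rewrite /open_ball/= => zy.
by apply: lt_le_trans zy _; rewrite ler_wiXn2l ?ltW.
Qed.

(** A family closed under intersection, as two code balls are nested or disjoint; [setT] provides
    the exhausting sequence for uniqueness of measures. *)
Definition code_balls : set (set borelK) :=
  [set A | A = setT \/ A = set0 \/ exists N n, A = code_ball N n].

Let code_balls_setI : setI_closed code_balls.
Proof.
move=> A A' [->|[->|[N [n ->]]]]; rewrite ?setTI ?set0I//; first by right; left.
move=> [->|[->|[M [m ->]]]]; rewrite ?setIT ?setI0.
- by right; right; exists N, n.
- by right; left.
have [NM|/ltnW MN] := leqP N M.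
  have [/setIidr ->|] := code_ball_nested n m NM; first by right; right; exists M, m.
  by rewrite setIC => ->; right; left.
have [/setIidl ->|->] := code_ball_nested m n MN; last by right; left.
by right; right; exists N, n.
Qed.

Lemma measurable_code_ball N n : measurable (code_ball N n).
Proof.
have [[x xN]|/set0P/negP/negbNE/eqP ->//] := pselect (code_ball N n !=set0).
by rewrite (code_ballE xN); exact: measurable_open_ball.
Qed.

(** An open set is the union of the countably many code balls that it contains. *)
Let measurable_code_balls : (measurable : set (set borelK)) = <<s code_balls >>.
Proof.
apply/seteqP; split; apply: smallest_sub.
- exact: smallest_sigma_algebra.
- move=> A Ao.
  have -> : A = \bigcup_N \bigcup_n
      (if `[< code_ball N n `<=` A >] then code_ball N n else set0).
    apply/seteqP; split=> [x Ax|x [N _ [n _]]]; last by case: asboolP => [+ xn|//]; apply.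
    have [r r0 rA] := (metric_openP A).1 Ao x Ax.
    have [N _ /(_ N (leqnn _))] := near_geometric_lt 1 (ltW u_gt0) u_lt1 r0.
    rewrite /= mul1r => uNr.
    exists N => //; exists (code (u ^- N * (x : K))) => //.
    rewrite asboolT// (@code_ballE _ _ x)// => y xy.
    by apply: rA; exact: lt_trans xy uNr.
  apply: sigma_algebra_bigcup => N; apply: sigma_algebra_bigcup => n.
  by apply: sub_sigma_algebra; case: ifP => _; right; [right; exists N, n|left].
- exact: sigma_algebra_measurable.
- move=> _ [->|[->|[N [n ->]]]] //; exact: measurable_code_ball.
Qed.

Let code_ball_unit_ball N n (x : K) : code_ball N n x -> B x -> code_ball N n `<=` B.
Proof.
move=> xN Bx y; rewrite (code_ballE xN) /open_ball/= => xy.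
rewrite /unit_ball/= -(subrK x y); apply: ultraD => //.
rewrite absvalB; apply: lt_le_trans xy _.
by rewrite exprn_ile1// ltW.
Qed.

(* If u and w are the masses under mu and nu of a ball of a given radius in B,
   then summing u * w over the balls of that radius partitioning B gives
   w * mu B = u * nu B. *)
Lemma ball_invariant_measure_unique (nu : {measure set borelK -> \bar R}) :
  (nu B < +oo)%E -> nu (~` B) = 0%E ->
  (forall N (x y : K), B x -> B y ->
    nu (open_ball x (v u ^+ N)) = nu (open_ball y (v u ^+ N))) ->
  forall A, measurable A -> nu A = (nu B * mu (A `&` B))%E.
Proof.
move=> nuB nuBC nuE.
have mB := measurable_unit_ball.
have nuBfin : nu B \is a fin_num by rewrite ge0_fin_numE.
have nuI A : measurable A -> nu A = nu (A `&` B).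
  move=> mA; rewrite (measureDI nu mA mB) [X in (X + _)%E](_ : _ = 0%E) ?add0e//.
  apply: (subset_measure0 _ _ _ nuBC); rewrite ?setDE; [|exact: measurableC|exact: subIsetr].
  exact/measurableI/measurableC.
have key N n (x : K) : code_ball N n x -> B x ->
    nu (code_ball N n) = (nu B * mu (code_ball N n))%E.
  move=> xN Bx; have PB := code_ball_unit_ball xN Bx.
  set c := mu (code_ball N n); set w := nu (code_ball N n).
  have le1 (m : {measure set borelK -> \bar R}) : (m B < +oo)%E ->
      m (code_ball N n) \is a fin_num.
    move=> mB'; rewrite ge0_fin_numE//; apply: le_lt_trans mB'.
    by apply: le_measure; rewrite ?inE//; exact: measurable_code_ball.
  have cfin : c \is a fin_num by apply: le1; rewrite muB ltry.
  have wfin : w \is a fin_num by exact: le1.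
  have mBn n' : measurable (B `&` [set y | code (u ^- N * (y : K)) = n']).
    by apply: measurableI => //; exact: measurable_code_ball.
  have := measure_fibers mu mBn; have := measure_fibers nu mBn.
  rewrite muB => nuS muS.
  rewrite -[LHS]mule1 muS -[w]fineK// -nneseriesZl//.
  rewrite muleC -[c]fineK// nuS -nneseriesZl//.
  apply: eq_eseriesr => k _.
  have [[y [By yk]]|/set0P/negP/negbNE/eqP ->] :=
      pselect (B `&` [set y | code (u ^- N * (y : K)) = k] !=set0); last first.
    by rewrite !measure0 !mule0.
  have yk' : code_ball N k y by [].
  rewrite (setIidr (code_ball_unit_ball yk' By)).
  rewrite -[X in mu X]/(code_ball N k) -[X in nu X]/(code_ball N k).
  rewrite (code_ballE yk') (mu_open_ball y x) (nuE N y x)// -(code_ballE xN).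
  by rewrite !fineK// muleC.
pose k : {nonneg R} := NngNum (fine_ge0 (measure_ge0 nu B)).
have kE : (k%:num)%:E = nu B by rewrite /= fineK.
have kmuE A : mscale k (mrestr mu mB) A = (nu B * mu (A `&` B))%E by rewrite -kE.
move=> A mA; rewrite -kmuE.
apply: (@measure_unique _ _ _ code_balls (fun _ => setT) measurable_code_balls
  code_balls_setI _ _ nu (mscale k (mrestr mu mB))) => //.
- by move=> _; left.
- by apply/seteqP; split=> // x _; exists 0%N.
- move=> _ [->|[->|[N [n ->]]]]; last rewrite [RHS]kmuE.
  + by rewrite [RHS]kmuE setTI muB mule1 [LHS]nuI// setTI.
  + by rewrite !measure0.
  + have [[x [xN xB]]|/set0P/negP/negbNE/eqP PB0] :=
        pselect (code_ball N n `&` B !=set0).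
      by rewrite (setIidl (code_ball_unit_ball xN xB)) (key _ _ _ xN xB).
    by rewrite [LHS]nuI ?PB0 ?measure0 ?mule0//; exact: measurable_code_ball.
- by move=> _; rewrite [X in (X < _)%E]nuI// setTI.
Qed.
End Ultrametric.

Arguments open_ball {R K} v x r _.

(** * The continued fraction map *)

Section ContinuedFractionMap.
Context (R : realType) (K : fieldType) (v : absolute_value R K).
Context (vU : ultrametric v).
Local Notation B := (unit_ball v).
Local Notation borelK := (borel_of v).
Context (mu : {measure set borelK -> \bar R}).
Context (mu_translation : forall (x : K) (A : set borelK), measurable A ->
    mu ([set x + y | y in (A : set K)] : set borelK) = mu A).
Context (muB : mu B = 1%E).
Context (code : K -> nat) (codeP : forall x y, code x = code y <-> v (x - y) < 1).
Context (u : K) (u_gt0 : 0 < v u) (u_lt1 : v u < 1).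
Context (fl : K -> K) (flB : forall x, v (x - fl x) < 1).
Context (fl_eq : forall x y, v (x - y) < 1 -> fl x = fl y).

Let mB := measurable_unit_ball vU.

Definition fraction_map (x : K) : K := if x == 0 then 0 else x^-1 - fl x^-1.
Local Notation T := (fraction_map : borelK -> borelK).

Lemma fraction_map_unit_ball x : B (T x).
Proof.
rewrite /unit_ball/= /fraction_map; case: ifP => _ //.
by rewrite absval0.
Qed.

Let absval_invB x y : x != 0 -> y != 0 -> v (x^-1 - y^-1) = v (x - y) / (v x * v y).
Proof.
move=> x0 y0; have -> : x^-1 - y^-1 = (y - x) / (x * y) by field; rewrite x0 y0.
by rewrite absvalM absvalV absvalM absvalB.
Qed.

Let inv_near x y r : x != 0 -> v (x - y) < v x -> v (x - y) < r * v x ^+ 2 ->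
  y != 0 /\ v (x^-1 - y^-1) < r.
Proof.
move=> x0 xy xyr; have yx := ultra_eq vU xy.
have y0 : y != 0 by rewrite -(absval_gt0 v) yx absval_gt0.
by split=> //; rewrite absval_invB// yx ltr_pdivrMr -?expr2// exprn_gt0// absval_gt0.
Qed.

(** Inversion is continuous off 0, so the hypothesis makes [A] without 0 open; what remains of [A]
    is empty or the closed set [[set 0]]. *)
Lemma measurable_off0 (A : set borelK) :
  (forall x : K, x != 0 -> A x ->
     exists2 r, 0 < r & forall y : K, y != 0 -> v (x^-1 - y^-1) < r -> A y) ->
  measurable A.
Proof.
move=> Ao; pose Z : set (metric_of v) := [set x : K | x != 0].
have Zo : open Z.
  apply/metric_openP => x x0; exists (v x); first by rewrite absval_gt0.
  by move=> y /(ultra_eq vU) yx; rewrite /Z/= -(absval_gt0 v) yx absval_gt0.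
have mZ : measurable (Z : set borelK) by exact: open_measurable_borel.
rewrite -(setUIDK A (Z : set borelK)); apply: measurableU.
  apply: open_measurable_borel; apply/metric_openP => x [Ax x0].
  have [r r0 rA] := Ao x x0 Ax.
  have vx0 : 0 < v x by rewrite absval_gt0.
  exists (Num.min (v x) (r * v x ^+ 2)).
    by rewrite lt_min vx0 mulr_gt0// exprn_gt0.
  move=> y; rewrite lt_min => /andP[xy xyr].
  by have [y0 yr] := inv_near x0 xy xyr; split=> //; exact: rA.
have [A0|A0] := pselect (A 0).
  rewrite (_ : A `\` _ = ~` (Z : set borelK)); first exact: measurableC.
  apply/seteqP; split=> [x []//|x nx]; split=> //.
  by move/negP/negbNE/eqP : nx => ->.
rewrite (_ : A `\` _ = set0)//; apply/seteqP; split=> // x [Ax].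
by move/negP/negbNE/eqP => x0; apply: A0; rewrite -x0.
Qed.

Let flV_near x y : v (x^-1 - y^-1) < 1 -> fl x^-1 = fl y^-1.
Proof. exact: fl_eq. Qed.

(** Off 0 the floor of [x^-1] is locally constant, so every function of it is measurable. *)
Lemma measurable_fun_floor_inv d (T2 : measurableType d) (psi : K -> T2) :
  measurable_fun [set: borelK] (fun x : K => psi (fl x^-1)).
Proof.
move=> _ A mA; rewrite setTI; apply: measurable_off0 => x x0 Ax.
by exists 1 => // y _ xy; rewrite /preimage/= -(flV_near xy).
Qed.

Lemma measurable_fraction_map : measurable_fun [set: borelK] T.
Proof.
apply: (@measurability _ _ borelK borelK setT T (@open (metric_of v))) => //.
move=> _ [U Uo <-]; rewrite setTI; apply: measurable_off0 => x x0 Ux.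
have [r r0 rU] := (metric_openP U).1 Uo _ Ux.
exists (Num.min 1 r); first by rewrite lt_min ltr01.
move=> y y0; rewrite lt_min => /andP[xy1 xyr]; apply: rU.
rewrite /fraction_map (negbTE x0) (negbTE y0) (flV_near xy1).
by rewrite opprB addrA subrK.
Qed.

(** The points whose first partial quotient has a given value, numbered by [code]; excluding 0
    leaves the points where [fraction_map] is defined by inversion. *)
Definition digit_cylinder n : set borelK :=
  [set x : K | B x /\ x != 0 /\ code x^-1 = n].
Local Notation C := digit_cylinder.

Lemma measurable_digit_cylinder n : measurable (C n).
Proof.
rewrite /digit_cylinder; apply: measurableI => //.
apply: measurable_off0 => x _ [x0 <-]; exists 1 => // y y0 /codeP xy.
by split.
Qed.
Let mC := measurable_digit_cylinder.

(** On the cylinder with quotient [c], [T] inverts [x |-> (c + x)^-1]. As [v (c + x) = v c > 1],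
    this map multiplies distances by exactly [1 / v c ^+ 2]. *)
Let cylinder_ball n (a x : K) r : C n a -> B x -> 0 < r -> r <= 1 ->
  T @^-1` open_ball v x r `&` C n =
  open_ball v (fl a^-1 + x)^-1 (r / v (fl a^-1) ^+ 2).
Proof.
move=> [Ba [a0 an]] Bx r0 r1; set c := fl a^-1.
have va : 1 < v a^-1 by rewrite absvalV invf_gt1// absval_gt0.
have vc1 : 1 < v c.
  by rewrite /c (ultra_eq vU (lt_trans (flB a^-1) va)).
have vc0 : 0 < v c by exact: lt_trans vc1.
have vcx : v (c + x) = v c by apply: (ultraDeq vU); exact: lt_trans vc1.
have cx0 : c + x != 0 by rewrite -(absval_gt0 v) vcx.
apply/seteqP; split=> [y [Ty [By [y0 yn]]]|y].
  have yc : fl y^-1 = c by apply: fl_eq; apply/codeP; rewrite yn an.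
  have vy : v y^-1 = v c.
    apply/esym/(ultra_eq vU); rewrite -yc.
    by apply: lt_trans (flB _) _; rewrite absvalV invf_gt1// absval_gt0.
  move: Ty; rewrite /open_ball/= /fraction_map (negbTE y0) yc => xy.
  rewrite -[y in X in v X]invrK absval_invB ?invr_eq0// vcx vy -expr2.
  rewrite ltr_pM2r ?invr_gt0 ?exprn_gt0//.
  by have -> : c + x - y^-1 = x - (y^-1 - c) by ring.
rewrite /open_ball/= => xy.
have rc : r / v c ^+ 2 < (v c)^-1.
  rewrite expr2 invfM mulrA -[ltRHS]mul1r ltr_pM2r ?invr_gt0// ltr_pdivrMr//.
  by rewrite mul1r; exact: le_lt_trans vc1.
have vy : v y = (v c)^-1.
  by rewrite -vcx -absvalV; apply: (ultra_eq vU); rewrite absvalV vcx; exact: lt_trans rc.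
have y0 : y != 0 by rewrite -(absval_gt0 v) vy invr_gt0.
have By : B y by rewrite /unit_ball/= vy invf_lt1.
have cxy : v (c + x - y^-1) < r.
  rewrite -(invrK (c + x)) absval_invB ?invr_eq0// absvalV vcx vy -invfM -expr2 invrK.
  by rewrite -ltr_pdivlMr// exprn_gt0.
have cy1 : v (c - y^-1) < 1.
  have -> : c - y^-1 = (c + x - y^-1) - x by ring.
  by apply: (ultraB vU) => //; exact: lt_le_trans r1.
have yc : fl y^-1 = c.
  rewrite -/c; apply/esym/fl_eq; apply: (ultra_trans vU _ cy1); exact: flB.
split; last by split=> //; split=> //; rewrite -an; apply/esym/codeP; apply: (ultra_trans vU _ cy1); exact: flB.
rewrite /open_ball/= /fraction_map (negbTE y0) yc.
by have -> : x - (y^-1 - c) = c + x - y^-1 by ring.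
Qed.

(** The image under [T] of [mu] restricted to the cylinder gives equal mass to balls of equal
    radius, by [cylinder_ball] and translation invariance, hence is a multiple of [mu] on the unit
    ball. *)
Lemma mu_cylinder_preimage n A : measurable A ->
  mu (T @^-1` A `&` C n) = (mu (C n) * mu (A `&` B))%E.
Proof.
pose nu := image_measure (mrestr mu (mC n)) measurable_fraction_map.
have nuE A' : nu A' = mu (T @^-1` A' `&` C n) by [].
have TB : T @^-1` B = setT.
  by apply/seteqP; split=> // x _; exact: fraction_map_unit_ball.
have nuB : nu B = mu (C n) by rewrite nuE TB setTI.
move=> mA; rewrite -nuE -nuB.
apply: (ball_invariant_measure_unique vU mu_translation muB codeP u_gt0 u_lt1) => //.
- rewrite nuB; apply: (@le_lt_trans _ _ 1%E); last by rewrite ltry.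
  by rewrite -muB; apply: le_measure; rewrite ?inE// => x [].
- rewrite nuE (_ : _ `&` _ = set0) ?measure0//; apply/seteqP; split=> // x [nBx _].
  exact: nBx (fraction_map_unit_ball x).
move=> N x y Bx By; rewrite !nuE.
have [[a Ca]|/set0P/negP/negbNE/eqP ->] := pselect (C n !=set0); last by rewrite !setI0.
have r0 : 0 < v u ^+ N by rewrite exprn_gt0.
have r1 : v u ^+ N <= 1 by rewrite exprn_ile1// ltW.
by rewrite !(cylinder_ball Ca)//; exact: mu_open_ball.
Qed.

(** All points have equal mass by translation invariance, and the infinitely many distinct points
    [u ^+ k.+1] lie in a ball of mass 1. *)
Lemma mu_set1_0 : mu ([set 0] : set borelK) = 0%E.
Proof.
have mx (x : K) : measurable ([set x] : set borelK).
  rewrite -[X in measurable X]setCK; apply: measurableC; apply: open_measurable_borel.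
  apply/metric_openP => y /eqP yx; exists (v (y - x)).
    by rewrite absval_gt0 subr_eq0.
  by move=> z yz zx; rewrite -zx ltxx in yz.
have muE (x : K) : mu ([set x] : set borelK) = mu ([set 0] : set borelK).
  rewrite -(mu_translation x (mx 0)); congr (mu _).
  apply/seteqP; split=> [_ ->|_ [_ -> <-]]; last by rewrite /= addr0.
  by exists 0 => //; rewrite addr0.
pose F k : set borelK := [set u ^+ k.+1].
have mF k : measurable (F k) by exact: mx.
have tF : trivIset setT F.
  apply/trivIsetP => i j _ _ ij; apply/seteqP; split=> // x [-> /(congr1 v)].
  rewrite !absvalX => /eqP; rewrite eq_le !ler_iXn2l//.
  by rewrite !ltnS -eqn_leq eq_sym (negbTE ij).
have FB : (\sum_(k <oo) mu (F k) <= 1)%E.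
  rewrite -muB -(measure_semi_bigcup _ mF tF); last exact: bigcup_measurable.
  apply: le_measure; rewrite ?inE//; first exact: bigcup_measurable.
  by move=> x [k _ ->]; rewrite /unit_ball/= absvalX exprn_ilt1// ltW.
apply/eqP; rewrite eq_le measure_ge0 andbT leNgt; apply/negP => c0.
have cfin : mu ([set 0] : set borelK) \is a fin_num.
  rewrite ge0_fin_numE//; apply: (@le_lt_trans _ _ 1%E); last by rewrite ltry.
  rewrite -muB; apply: le_measure; rewrite ?inE//.
  by move=> x ->; rewrite /unit_ball/= absval0.
move: c0 FB; rewrite -(fineK cfin) lte_fin; set c := fine _ => c0 FB.
pose N := Num.bound c^-1.
have : (\sum_(0 <= k < N) mu (F k) <= 1)%E.
  by apply: le_trans FB; apply: nneseries_lim_ge => k _ _.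
under eq_bigr do rewrite /F muE -(fineK cfin) -/c.
rewrite sumEFin sumr_const_nat subn0 lee_fin -mulr_natl -ler_pdivlMr// div1r.
by rewrite leNgt archi_boundP// invr_ge0 ltW.
Qed.

(** * Integration over cylinders: independence and invariance *)

Let B0 : set borelK := B `\` [set 0].

Let m0 : measurable ([set 0] : set borelK).
Proof.
apply: measurable_off0 => x x0 /= x00.
by rewrite x00 eqxx in x0.
Qed.

Let B0_bigcup : B0 = \bigcup_n C n.
Proof.
apply/seteqP; split=> [x [Bx /eqP x0]|x [n _ [Bx [/eqP x0 _]]]] //.
by exists (code (x : K)^-1).
Qed.

Let C_triv : trivIset setT C.
Proof.
apply/trivIsetP => i j _ _ /eqP ij; apply/seteqP; split=> // x [[_ [_ xi]] [_ [_ xj]]].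
by apply: ij; rewrite -xi.
Qed.

Local Open Scope ereal_scope.

Let integral_C (h : borelK -> \bar R) : measurable_fun setT h -> (forall x, 0 <= h x) ->
  \int[mu]_(x in B) h x = \sum_(n <oo) \int[mu]_(x in C n) h x.
Proof.
move=> mh h0.
rewrite (ge0_negligible_integral m0 mB _ _ mu_set1_0)//; last exact: measurable_funTS.
by rewrite -/B0 B0_bigcup ge0_integral_bigcup//; exact: measurable_funTS.
Qed.

Let integral_C_map n (g : borelK -> \bar R) : measurable_fun setT g ->
  (forall x, 0 <= g x) ->
  \int[mu]_(x in C n) g (T x) = mu (C n) * \int[mu]_(x in B) g x.
Proof.
move=> mg g0; have mT := measurable_fraction_map.
have Cfin : mu (C n) \is a fin_num.
  rewrite ge0_fin_numE//; apply: (@le_lt_trans _ _ 1); last by rewrite ltry.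
  by rewrite -muB; apply: le_measure; rewrite ?inE// => x [].
rewrite -(ge0_integral_mrestr mu (mC n)); [|exact: measurableT_comp mg mT|by []].
have TB : T @^-1` B = setT.
  by apply/seteqP; split=> // x _; exact: fraction_map_unit_ball.
rewrite -[LHS]/(\int[mrestr mu (mC n)]_x (g \o T) x) -TB.
rewrite -(ge0_integral_pushforward mT)//; last exact: measurable_funTS.
pose k : {nonneg R} := NngNum (fine_ge0 (measure_ge0 mu (C n))).
transitivity (\int[mscale k mu]_(y in B) g y); last first.
  rewrite ge0_integral_mscale//; last exact: measurable_funTS.
  by rewrite /= fineK.
apply: (@eq_measure_integral _ _ _ _ (mscale k mu) (image_measure (mrestr mu (mC n)) mT)).
move=> A mA AB; rewrite -[RHS]/((fine (mu (C n)))%:E * mu A) fineK//.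
by rewrite -[LHS]/(mu (T @^-1` A `&` C n)) mu_cylinder_preimage// setIidl.
Qed.

(** Independence of the first partial quotient from [T x]: the factor [psi] is constant on each
    cylinder, where [T] carries [mu] to a multiple of [mu], and the cylinders exhaust the ball up to
    a null set. *)
Lemma integral_floor_inv_map (psi : K -> R) (g : borelK -> \bar R) :
  (forall x, (0 <= psi x)%R) -> measurable_fun setT g -> (forall x, 0 <= g x) ->
  \int[mu]_(x in B) g x < +oo ->
  \int[mu]_(x in B) ((psi (fl (x : K)^-1))%:E * g (T x)) =
  \int[mu]_(x in B) (psi (fl (x : K)^-1))%:E * \int[mu]_(x in B) g x.
Proof.
move=> psi0 mg g0 gfin.
have mpsi : measurable_fun [set: borelK] (fun x : K => (psi (fl x^-1))%:E).
  exact: (measurable_fun_floor_inv (fun c => (psi c)%:E)).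
have mgT : measurable_fun [set: borelK] (fun x : K => g (T x)).
  exact: measurableT_comp mg measurable_fraction_map.
have Gfin : \int[mu]_(x in B) g x \is a fin_num.
  by rewrite ge0_fin_numE// integral_ge0.
set G := \int[mu]_(x in B) g x in Gfin *.
rewrite !integral_C//; last 3 first.
- by move=> x; rewrite lee_fin.
- exact: emeasurable_funM.
- by move=> x; rewrite mule_ge0// lee_fin.
rewrite muleC -(fineK Gfin) -nneseriesZl; last first.
  by move=> n _; apply: integral_ge0 => x _; rewrite lee_fin.
apply: eq_eseriesr => n _.
have [[a [Ba [a0 an]]]|/set0P/negP/negbNE/eqP ->] := pselect (C n !=set0); last first.
  by rewrite !integral_set0 mule0.
have psiE x : C n x -> psi (fl (x : K)^-1) = psi (fl a^-1).
  by move=> [_ [_ xn]]; congr psi; apply: fl_eq; apply/codeP; rewrite xn an.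
transitivity (\int[mu]_(x in C n) ((psi (fl a^-1))%:E * g (T x))).
  by apply: eq_integral => x /set_mem Cx; rewrite psiE.
rewrite ge0_integralZl_EFin//; last exact: measurable_funTS.
rewrite integral_C_map// -/G fineK//.
rewrite [X in _ = _ * X](_ : _ = \int[mu]_(x in C n) (cst (psi (fl a^-1))%:E x)).
  by rewrite integral_cst// muleA muleC.
by apply: eq_integral => x /set_mem Cx; rewrite psiE.
Qed.

(** Invariance of [mu] under [T] is the case of a constant [psi] equal to 1. *)
Lemma integral_fraction_map (g : borelK -> \bar R) :
  measurable_fun setT g -> (forall x, 0 <= g x) -> \int[mu]_(x in B) g x < +oo ->
  \int[mu]_(x in B) g (T x) = \int[mu]_(x in B) g x.
Proof.
move=> mg g0 gfin.
have := @integral_floor_inv_map (fun=> 1%R) g (fun=> ler01) mg g0 gfin.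
under eq_integral do rewrite mul1e.
by move=> ->; rewrite integral_cst// mul1e muB mul1e.
Qed.

Lemma measurable_iter_fraction_map k : measurable_fun setT (iter k T : borelK -> borelK).
Proof.
elim: k => [|k IH]; first exact: measurable_id.
exact: measurableT_comp measurable_fraction_map IH.
Qed.

Lemma integral_iter_fraction_map k (g : borelK -> \bar R) :
  measurable_fun setT g -> (forall x, 0 <= g x) -> \int[mu]_(x in B) g x < +oo ->
  \int[mu]_(x in B) g (iter k T x) = \int[mu]_(x in B) g x.
Proof.
elim: k g => [|k IH] g mg g0 gfin //=.
have mgT : measurable_fun setT (g \o T) by exact: measurableT_comp mg measurable_fraction_map.
have gTE := integral_fraction_map mg g0 gfin.
rewrite -gTE; apply: (IH (g \o T)) => [//|x|]; first exact: g0.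
by rewrite /comp gTE.
Qed.

(** * Second moments of functions of the partial quotients *)

Context (psi : K -> R) (psi_ge0 : forall x, (0 <= psi x)%R) (M E2 : R).
Context (psiM : \int[mu]_(x in B) (psi (fl (x : K)^-1))%:E = M%:E).
Context (psiE2 : \int[mu]_(x in B) ((psi (fl (x : K)^-1)) ^+ 2)%:E = E2%:E).

Let X k (x : borelK) : R := psi (fl (iter k T x : K)^-1).

Let X_ge0 k x : (0 <= X k x)%R.
Proof. exact: psi_ge0. Qed.

Lemma measurable_quotient k : measurable_fun setT (X k).
Proof.
exact: measurableT_comp (measurable_fun_floor_inv psi) (measurable_iter_fraction_map k).
Qed.
Let mX := measurable_quotient.

Let mEX k : measurable_fun setT (EFin \o X k).
Proof. by apply/measurable_EFinP. Qed.

Let integral_X k : \int[mu]_(x in B) (X k x)%:E = M%:E.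
Proof.
rewrite -psiM.
apply: (@integral_iter_fraction_map k (fun x : borelK => (psi (fl (x : K)^-1))%:E)).
- exact: (mEX 0).
- by move=> x; rewrite lee_fin.
- by rewrite psiM ltry.
Qed.

(** Invariance moves the earlier index to 0; the later factor is then a function of [T x], and
    independence splits the integral. *)
Let integral_XX_lt k l : (k < l)%N ->
  \int[mu]_(x in B) (X k x * X l x)%:E = (M * M)%:E.
Proof.
move=> /subnK <-; set m := (l - k.+1)%N.
pose h (x : borelK) := (psi (fl (x : K)^-1))%:E * (X m (T x))%:E.
have mh : measurable_fun setT h.
  apply: emeasurable_funM; first exact: (mEX 0).
  exact: measurableT_comp (mEX m) measurable_fraction_map.
have hE : \int[mu]_(x in B) h x = (M * M)%:E.
  rewrite /h (integral_floor_inv_map psi_ge0 (mEX m)) ?psiM ?integral_X ?ltry//.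
  by move=> x; rewrite /= lee_fin; exact: psi_ge0.
rewrite -hE -[RHS](integral_iter_fraction_map k) ?hE ?ltry//; last first.
  by move=> x; rewrite mule_ge0 ?lee_fin//; exact: psi_ge0.
by apply: eq_integral => x _; rewrite /h -EFinM /X iterD iterS.
Qed.

(** The diagonal bound carries an extra [M * M] so that one formula covers all pairs and the double
    sum becomes [s * E2 + (s * M) ^+ 2]. *)
Let integral_XX k l :
  \int[mu]_(x in B) (X k x * X l x)%:E <= ((k == l)%:R * E2 + M * M)%:E.
Proof.
have [kl|lk|<-] := ltngtP k l.
- by rewrite integral_XX_lt// mul0r add0r.
- by under eq_integral do rewrite mulrC; rewrite integral_XX_lt// mul0r add0r.
rewrite mul1r; under eq_integral do rewrite -expr2.
rewrite (@integral_iter_fraction_map k (fun x : borelK => (psi (fl (x : K)^-1) ^+ 2)%:E)).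
- by rewrite psiE2 lee_fin lerDl -expr2 sqr_ge0.
- by apply/measurable_EFinP; apply: measurable_funX; exact: (mX 0).
- by move=> x; rewrite lee_fin sqr_ge0.
- by rewrite psiE2 ltry.
Qed.

(* Adding the cross term [2 s M S] keeps every integrand nonnegative. *)
Lemma block_variance a s :
  \int[mu]_(x in B) ((\sum_(k < s) X (a + k) x - s%:R * M) ^+ 2)%:E <= (s%:R * E2)%:E.
Proof.
pose S (x : borelK) : R := (\sum_(k < s) X (a + k) x)%R.
have S0 x : (0 <= S x)%R by apply: sumr_ge0 => k _; exact: psi_ge0.
have M0 : (0 <= M)%R.
  by rewrite -lee_fin -psiM; apply: integral_ge0 => x _; rewrite lee_fin.
have mS : measurable_fun setT S by exact: measurable_sum.
have sM0 : (0 <= 2 * (s%:R * M))%R by rewrite !mulr_ge0.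
have intS : \int[mu]_(x in B) (S x)%:E = (s%:R * M)%:E.
  under eq_integral do rewrite /S -sumEFin.
  rewrite ge0_integral_sum//; last 2 first.
  - by move=> k; apply: measurable_funTS; exact: mEX.
  - by move=> k x _; rewrite lee_fin.
  under eq_bigr do rewrite integral_X.
  by rewrite sumEFin sumr_const card_ord mulr_natl.
have intS2 : \int[mu]_(x in B) ((S x) ^+ 2)%:E <= (s%:R * E2 + (s%:R * M) ^+ 2)%:E.
  have SE x : ((S x) ^+ 2)%:E = \sum_(k < s) \sum_(l < s) (X (a + k) x * X (a + l) x)%:E.
    rewrite /S expr2 mulr_suml -sumEFin; apply: eq_bigr => k _.
    by rewrite mulr_sumr -sumEFin.
  under eq_integral do rewrite SE.
  have mXX k l : measurable_fun setT (fun x => (X k x * X l x)%:E).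
    by apply/measurable_EFinP; exact: measurable_funM.
  rewrite ge0_integral_sum//; last 2 first.
  - move=> k; apply: measurable_funTS; apply: emeasurable_sum => l; exact: mXX.
  - by move=> k x _; apply: sume_ge0 => l _; rewrite lee_fin mulr_ge0.
  apply: (@le_trans _ _ (\sum_(k < s) \sum_(l < s) ((k == l)%:R * E2 + M * M)%:E)).
    apply: lee_sum => k _; rewrite ge0_integral_sum//; last 2 first.
    - by move=> l; apply: measurable_funTS; exact: mXX.
    - by move=> l x _; rewrite lee_fin mulr_ge0.
    apply: lee_sum => l _; apply: le_trans (integral_XX _ _) _.
    by rewrite eqn_add2l.
  have inner (k : 'I_s) : (\sum_(l < s) ((k == l)%:R * E2 + M * M) = E2 + s%:R * (M * M))%R.
    rewrite big_split/= sumr_const card_ord mulr_natl; congr (_ + _)%R.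
    rewrite (bigD1 k)//= eqxx mul1r big1 ?addr0// => l.
    by rewrite eq_sym => /negbTE ->; rewrite mul0r.
  under eq_bigr do rewrite sumEFin inner.
  rewrite sumEFin sumr_const card_ord lee_fin -mulr_natl; lra.
have dev : \int[mu]_(x in B) ((S x - s%:R * M) ^+ 2)%:E + (2 * (s%:R * M) * (s%:R * M))%:E =
    \int[mu]_(x in B) ((S x) ^+ 2)%:E + ((s%:R * M) ^+ 2)%:E.
  have <- : \int[mu]_(x in B) ((2 * (s%:R * M))%:E * (S x)%:E) =
      (2 * (s%:R * M) * (s%:R * M))%:E.
    rewrite ge0_integralZl_EFin ?intS//.
    - by move=> x _; rewrite lee_fin.
    - by apply: measurable_funTS; apply/measurable_EFinP.
  have <- : \int[mu]_(x in B) (cst ((s%:R * M) ^+ 2)%:E x) = ((s%:R * M) ^+ 2)%:E.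
    by rewrite integral_cst// muB mule1.
  rewrite -!ge0_integralD//.
  - by apply: eq_integral => x _; rewrite /= -EFinM -!EFinD; congr EFin; ring.
  all: try by move=> x _; rewrite ?mule_ge0 ?lee_fin ?sqr_ge0.
  - by apply: measurable_funTS; apply/measurable_EFinP; apply: measurable_funX.
  - apply: measurable_funTS; apply/measurable_EFinP; apply: measurable_funX.
    exact: measurable_funB.
  - apply: measurable_funTS; apply: emeasurable_funM => //.
    by apply/measurable_EFinP.
rewrite -(leeD2rE (x := (2 * (s%:R * M) * (s%:R * M))%:E))// dev.
apply: (@le_trans _ _ ((s%:R * E2 + (s%:R * M) ^+ 2)%:E + ((s%:R * M) ^+ 2)%:E)).
  by rewrite leeD2r.
by rewrite -!EFinD lee_fin; lra.
Qed.
End ContinuedFractionMap.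

(** * Averages along Stoltz sequences *)

Lemma sum_nat_blocks (R : realType) (g : nat -> R) s i j : (i <= j)%N ->
  \sum_(i * s <= l < j * s) g l = \sum_(i <= k < j) \sum_(o < s) g (k * s + o)%N.
Proof.
elim: j => [|j IH]; first by rewrite leqn0 => /eqP ->; rewrite !big_geq.
rewrite leq_eqVlt => /orP[/eqP ->|ij]; first by rewrite !big_geq.
rewrite big_nat_recr//= -IH// (big_cat_nat (n := (j * s)%N)) ?leq_mul2r ?leqnSn ?orbT//=.
  congr (_ + _); rewrite -[(j * s)%N in LHS]add0n big_addn mulSn addnK big_mkord.
  by apply: eq_bigr => o _; rewrite addnC.
by rewrite -ltnS ij orbT.
Qed.

Lemma ler_sum_subinterval (R : realType) (g : nat -> R) (i i' j' j : nat) :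
  (forall l, 0 <= g l) -> (i <= i')%N -> (i' <= j')%N -> (j' <= j)%N ->
  \sum_(i' <= l < j') g l <= \sum_(i <= l < j) g l.
Proof.
move=> g0 ii ij jj; have ij' := leq_trans ij jj.
rewrite [leRHS](@big_cat_nat _ _ _ i' i j)//= [X in _ <= _ + X](@big_cat_nat _ _ _ j' i' j)//=.
have h1 : 0 <= \sum_(i <= l < i') g l by exact: sumr_ge0.
have h2 : 0 <= \sum_(j' <= l < j) g l by exact: sumr_ge0.
lra.
Qed.

(* The window [a, a + b) lies between two unions of whole blocks [i s, (i+1) s)
   that differ from it by at most 2 s elements. *)
Lemma window_block_average (R : realType) (g : nat -> R) (M delta : R) (a b s q : nat) :
  (0 < s)%N -> (0 < q)%N -> (forall l, 0 <= g l) -> 0 <= M -> 0 <= delta ->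
  (q * s <= b < 2 * q * s)%N ->
  (forall j, (j < 2 * q + 1)%N ->
     `|(\sum_(o < s) g ((a %/ s + j) * s + o)%N) - s%:R * M| <= s%:R * delta) ->
  `|\sum_(l < b) g (a + l)%N - b%:R * M| <= b%:R * delta + 2 * s%:R * (M + delta).
Proof.
move=> s0 q0 g0 M0 d0 /andP[qb bq] blk.
set i0 := (a %/ s)%N; set i1 := ((a + b) %/ s)%N.
have a1 : (i0 * s <= a)%N by exact: leq_trunc_div.
have a2 : (a < (i0 + 1) * s)%N by rewrite addn1 ltn_ceil.
have ab1 : (i1 * s <= a + b)%N by exact: leq_trunc_div.
have ab2 : (a + b < (i1 + 1) * s)%N by rewrite addn1 ltn_ceil.
have i01 : (i0 + 1 <= i1)%N.
  by rewrite addn1 -ltnS -(ltn_pmul2r s0) -addn1; nia.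
have i1q : (i1 < i0 + (2 * q + 1))%N by rewrite -(ltn_pmul2r s0); nia.
have blk' k : (i0 <= k <= i1)%N ->
    s%:R * (M - delta) <= \sum_(o < s) g (k * s + o)%N <= s%:R * (M + delta).
  move=> /andP[ik ki]; have := blk (k - i0)%N; rewrite subnKC// ler_norml.
  have -> : (k - i0 < 2 * q + 1)%N by lia.
  by move=> /(_ isT) /andP[]; lra.
have sumE : \sum_(l < b) g (a + l)%N = \sum_(a <= l < a + b) g l.
  rewrite -[a in RHS]add0n -[in RHS](addnC b) big_addn addnK big_mkord.
  by apply: eq_bigr => o _; rewrite addnC.
have cstsum (c : R) i j : \sum_(i <= k < j) c = (j - i)%N%:R * c.
  by rewrite sumr_const_nat mulr_natl.
have up : \sum_(a <= l < a + b) g l <= (b%:R + 2 * s%:R) * (M + delta).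
  apply: (@le_trans _ _ (\sum_(i0 * s <= l < (i1 + 1) * s) g l)).
    by apply: ler_sum_subinterval => //; [exact: leq_addr|exact: ltnW].
  rewrite sum_nat_blocks; last by lia.
  apply: (@le_trans _ _ (\sum_(i0 <= k < i1 + 1) (s%:R * (M + delta)))).
    apply: ler_sum_nat => k /andP[ik ki].
    have kk : (i0 <= k <= i1)%N by lia.
    have /andP[_ h] := blk' k kk; exact: h.
  rewrite cstsum mulrA -natrM -(natrM _ 2) -natrD ler_wpM2r ?addr_ge0// ler_nat; nia.
(* Lowering the number of inner blocks to the bound [b - 2 s] divided by [s] requires a nonnegative
   [M - delta]. When [M <= delta], the final lower bound follows from nonnegativity of the sum. *)
have lo : (b%:R - 2 * s%:R) * (M - delta) <= \sum_(a <= l < a + b) g l \/ M - delta <= 0.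
  have [Md|Md] := lerP (M - delta) 0; [by right|left].
  apply: (@le_trans _ _ (\sum_((i0 + 1) * s <= l < i1 * s) g l)); last first.
    apply: ler_sum_subinterval => //; first exact: ltnW.
    by rewrite leq_mul2r i01 orbT.
  rewrite sum_nat_blocks//.
  apply: (@le_trans _ _ (\sum_(i0 + 1 <= k < i1) (s%:R * (M - delta)))); last first.
    apply: ler_sum_nat => k /andP[ik ki].
    have kk : (i0 <= k <= i1)%N by lia.
    have /andP[h _] := blk' k kk; exact: h.
  rewrite cstsum mulrA; apply: ler_wpM2r; first exact: ltW.
  by rewrite lerBlDr -!natrM -natrD ler_nat; nia.
have s0' : 0 <= s%:R :> R by [].
have b0' : 0 <= b%:R :> R by [].
have sum0 : 0 <= \sum_(a <= l < a + b) g l by exact: sumr_ge0.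
rewrite sumE ler_norml; apply/andP; split; last by lra.
case: lo => [lo|lo]; nra.
Qed.

(* If q s <= b n < 2 q s with kappa q >= 1, then every integer of the block
   [i s, (i+1) s) containing a n belongs to the cone section at height 3 q s,
   whose cardinality is at most 3 A q s; hence there are at most 3 A q such blocks. *)
Lemma stoltz_blocks (R : realType) (a b : nat -> nat) : stoltz R a b ->
  (forall N : nat, exists n0 : nat, forall n, (n0 <= n)%N -> (N <= b n)%N) /\
  exists n0 q0 : nat, (0 < q0)%N /\ forall q : nat, (q0 <= q)%N ->
    exists c : nat, forall s : nat, (0 < s)%N ->
      exists2 I : seq nat, (size I <= c)%N &
        forall n, (n0 <= n)%N -> (q * s <= b n < 2 * q * s)%N -> (a n %/ s)%N \in I.
Proof.
move=> [Om [h [_ [h0 hoo] abO [l [kap [A [l0 kap0 A0 Acard]]]]]]].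
have hbig (y : R) : exists2 n0 : nat, (0 < n0)%N & forall n, (n0 <= n)%N -> above Om y ((a n)%:Z, b n).
  have [t0 _ ht0] : \forall t \near \oo, y <= h t by move/cvgryPge : hoo; apply.
  (* The successor guarantees [1 <= n], where the indexing of the sequence starts. *)
  exists t0.+1 => // n tn; have [] := abO t0 n (leq_trans _ tn) (ltnW tn).
    by [].
  by move=> O1 hb; split=> //; apply: le_trans (ht0 t0 (leqnn _)) hb.
split.
  move=> N; have [n0 _ Hn0] := hbig N%:R; exists n0 => n /Hn0[_].
  by rewrite ler_nat.
have [n0 _ Hn0] := hbig l.
exists n0, (Num.bound kap^-1).+1; split=> // q qq.
have kq : 1 <= kap * q%:R.
  rewrite -ler_pdivrMl// mulr1 ltW// (lt_le_trans (archi_boundP _))//.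
    by rewrite invr_ge0 ltW.
  by rewrite ler_nat ltnW.
have q0 : (0 < q)%N by exact: leq_trans qq.
exists (Num.bound (A * (3 * q)%:R)) => s s0.
have lam0 : (0 < 3 * q * s)%N by rewrite !muln_gt0 q0.
have [Sfin Scard] := Acard _ lam0.
set S := cone_section Om l kap (3 * q * s) in Sfin Scard.
pose P i := exists n, [/\ (n0 <= n)%N, (q * s <= b n < 2 * q * s)%N & (a n %/ s)%N = i].
(* Such an integer is at distance less than [s] from [a n], while the height [3 * q * s] exceeds
   [b n] by at least [q * s], and [kap * q >= 1]. *)
have PS i o : P i -> (o < s)%N -> S (i * s + o)%N%:Z.
  move=> [n [nn /andP[qb bq] <-]] os.
  exists ((a n)%:Z, b n); first exact: Hn0.
  rewrite /=; set z : int := _ - _.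
  have z1 : `|z| < s%:Z.
    by rewrite /z {2}(divn_eq (a n) s); have := ltn_pmod (a n) s0; lia.
  apply: (@lt_le_trans _ _ s%:~R); first by rewrite ltr_int.
  apply: (@le_trans _ _ (kap * (q * s)%N%:~R)).
    by rewrite -!pmulrn natrM mulrA ler_peMl.
  by apply: ler_wpM2l; [exact: ltW|rewrite ler_int; lia].
pose I := undup [seq (`|z| %/ s)%N | z <- fset_set S & `[< P (`|z| %/ s)%N >]].
have PI i : i \in I -> P i.
  by rewrite mem_undup => /mapP[z]; rewrite mem_filter => /andP[/asboolP Pz _ ->].
exists I; last first.
  move=> n nn bn; have Pn : P (a n %/ s)%N by exists n.
  rewrite mem_undup; apply/mapP; exists ((a n %/ s)%N * s)%N%:Z; last by rewrite /= mulnK.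
  rewrite mem_filter /= mulnK// asboolT//= in_fset_set// inE.
  by have := PS _ 0%N Pn s0; rewrite addn0.
(* Each listed block contributes [s] distinct points to the section, so [size I * s] is bounded by
   its cardinality. *)
have : (size [seq (i * s + o)%N%:Z | i <- I, o <- iota 0 s] <= size (fset_set S))%N.
  apply: uniq_leq_size.
    apply: allpairs_uniq; rewrite ?undup_uniq ?iota_uniq//.
    move=> [i o] [i' o'] /allpairsP[[x1 x2] [_ x2s [-> ->]]] /allpairsP[[y1 y2] [_ y2s [-> ->]]] [xy].
    rewrite !mem_iota/= add0n in x2s y2s.
    have o12 : x2 = y2.
      by have := congr1 (modn^~ s) xy; rewrite !modnMDl !modn_small.
    by move: xy; rewrite o12 => /eqP; rewrite eqn_add2r eqn_pmul2r// => /eqP ->.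
  move=> z /allpairsP[[i o] [/= /PI Pi os ->]].
  by rewrite in_fset_set// inE; apply: PS => //; rewrite mem_iota add0n in os.
rewrite size_allpairs size_iota => szI.
have : (size I)%:R <= A * (3 * q)%:R.
  have : (size I * s)%:R <= A * (3 * q * s)%:R by apply: le_trans Scard; rewrite ler_nat.
  by rewrite !natrM !mulrA ler_pM2r// ltr0n.
move=> szA; rewrite -(ler_nat R); apply: le_trans szA _.
by apply/ltW/archi_boundP; rewrite mulr_ge0// ltW.
Qed.

Section AlmostSureAverages.
Context d (T : measurableType d) (R : realType) (mu : {measure set T -> \bar R}).
Context (D : set T) (mD : measurable D).

(** The bounds on the integrals are summable, so by monotone convergence the series of the [h k] has
    finite integral; it converges almost everywhere and its terms tend to 0. *)
Lemma ae_cvg0_summable (h : nat -> T -> R) (C : R) : (forall k, measurable_fun setT (h k)) ->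
  (forall k x, 0 <= h k x) -> 0 <= C ->
  (forall k, \int[mu]_(x in D) (h k x)%:E <= (C / (2 ^ k.+1)%:R)%:E)%E ->
  {ae mu, forall x, D x -> h k x @[k --> \oo] --> 0}.
Proof.
move=> mh h0 C0 hC.
have mEh k : measurable_fun D (fun x => (h k x)%:E).
  by apply: measurable_funTS; apply/measurable_EFinP.
pose G x := (\sum_(k <oo) (h k x)%:E)%E.
have G0 x : (0 <= G x)%E by apply: nneseries_ge0 => k _ _; rewrite lee_fin.
have intG : mu.-integrable D G.
  apply/integrableP; split.
    by apply: ge0_emeasurable_sum => [k x _ _|k _]; [rewrite lee_fin|exact: mEh].
  under eq_integral do rewrite gee0_abs//.
  rewrite integral_nneseries//; last by move=> k x _; rewrite lee_fin.
  apply: le_lt_trans (ltry C); apply: le_trans (epsilon_trick0 xpredT C0).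
  apply: lee_nneseries => [k _ _|k _]; last exact: hC.
  by apply: integral_ge0 => x _; rewrite lee_fin.
apply: filterS (integrable_ae mD intG) => x Gfin Dx.
have {}Gfin := Gfin Dx.
apply: cvg_series_cvg_0; apply: nondecreasing_is_cvgn.
  apply/nondecreasing_seqP => n; rewrite /series/= big_nat_recr//= lerDl.
  exact: h0.
exists (fine (G x)) => _ [n _ <-]; rewrite -lee_fin fineK// /series/= -sumEFin.
by apply: nneseries_lim_ge => k _ _; rewrite lee_fin.
Qed.

Context (X : nat -> T -> R) (M V : R).
Context (mX : forall k, measurable_fun setT (X k)) (X_ge0 : forall k x, 0 <= X k x).
Context (M_ge0 : 0 <= M) (V_ge0 : 0 <= V).
Context (XV : forall l s,
  (\int[mu]_(x in D) ((\sum_(k < s) X (l + k) x - s%:R * M) ^+ 2)%:E <= (s%:R * V)%:E)%E).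

Theorem stoltz_averages_cvg (a b : nat -> nat) : stoltz R a b ->
  {ae mu, forall x, D x ->
    (\sum_(l < b n) X (a n + l) x) / (b n)%:R @[n --> \oo] --> M}.
Proof.
move=> /stoltz_blocks[binf [n0 [q0 [q0_gt0 blocks]]]].
pose dev s i x := ((\sum_(o < s) X (i * s + o) x - s%:R * M) / s%:R) ^+ 2.
have dev0 s i x : 0 <= dev s i x by exact: sqr_ge0.
have mdev s i : measurable_fun setT (dev s i).
  apply: measurable_funX; apply: measurable_funM => //.
  by apply: measurable_funB => //; exact: measurable_sum.
have intdev s i : (0 < s)%N -> (\int[mu]_(x in D) (dev s i x)%:E <= (V / s%:R)%:E)%E.
  move=> s0; have s0' : 0 < s%:R :> R by rewrite ltr0n.
  under eq_integral do rewrite /dev expr_div_n mulrC EFinM.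
  rewrite ge0_integralZl_EFin//; last 2 first.
  - by move=> x _; rewrite lee_fin sqr_ge0.
  - apply: measurable_funTS; apply/measurable_EFinP; apply: measurable_funX.
    by apply: measurable_funB => //; exact: measurable_sum.
  apply: (@le_trans _ _ ((s%:R ^- 2)%:E * (s%:R * V)%:E)%E).
    by apply: lee_wpmul2l; [rewrite lee_fin invr_ge0 sqr_ge0|exact: XV].
  rewrite -EFinM lee_fin le_eqVlt; apply/orP; left; apply/eqP.
  by field; rewrite gt_eqF.
(* The exceptional null set may depend on [q], since only countably many [q] occur; it serves all
   [delta] at once. *)
have aeq q : {ae mu, forall x, D x -> (q0 <= q)%N -> forall delta, 0 < delta ->
    exists k0 : nat, forall k n j, (k0 <= k)%N -> (n0 <= n)%N ->
      (q * 2 ^ k <= b n < 2 * q * 2 ^ k)%N -> (j < 2 * q + 1)%N ->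
      dev (2 ^ k)%N (a n %/ 2 ^ k + j)%N x < delta}.
  have [qq|qq] := leqP q0 q; last first.
    exact/aeW.
  have [c cP] := blocks q qq.
  have /choice[I IP] (k : nat) : exists I : seq nat, (size I <= c)%N /\
      forall n, (n0 <= n)%N -> (q * 2 ^ k <= b n < 2 * q * 2 ^ k)%N ->
        (a n %/ 2 ^ k)%N \in I.
    by have [|I] := cP (2 ^ k)%N; [rewrite expn_gt0|exists I].
  (* This dominates the deviation of every block that a window of scale [k] can meet: at most [c]
     initial blocks, each followed over [2 * q + 1] consecutive blocks. Its integral is therefore
     [O(1 / 2 ^ k)]. *)
  pose Y k x := \sum_(i <- I k) \sum_(j < 2 * q + 1) dev (2 ^ k)%N (i + j)%N x.
  have Y0 k x : 0 <= Y k x by apply: sumr_ge0 => i _; exact: sumr_ge0.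
  have mY k : measurable_fun setT (Y k).
    by apply: measurable_sum => i; exact: measurable_sum.
  pose C := 2 * (c%:R * ((2 * q + 1)%:R * V)).
  have C0 : 0 <= C by rewrite !mulr_ge0.
  have intY k : (\int[mu]_(x in D) (Y k x)%:E <= (C / (2 ^ k.+1)%:R)%:E)%E.
    have mEdev i : measurable_fun D (EFin \o dev (2 ^ k)%N i).
      by apply: measurable_funTS; apply/measurable_EFinP.
    have -> : (\int[mu]_(x in D) (Y k x)%:E = \sum_(i <- I k) \sum_(j < 2 * q + 1)
        \int[mu]_(x in D) (dev (2 ^ k)%N (i + j)%N x)%:E)%E.
      under eq_integral do rewrite /Y -sumEFin.
      rewrite ge0_integral_sum//; last 2 first.
      - move=> i; apply: measurable_funTS; apply/measurable_EFinP.
        exact: measurable_sum.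
      - by move=> i x _; rewrite lee_fin sumr_ge0.
      apply: eq_bigr => i _; under eq_integral do rewrite -sumEFin.
      rewrite ge0_integral_sum//; last 2 first.
      - by move=> j; exact: mEdev.
      - by move=> j x _; rewrite lee_fin.
    apply: (@le_trans _ _ (\sum_(i <- I k) \sum_(j < 2 * q + 1) (V / (2 ^ k)%:R)%:E)%E).
      apply: lee_sum => i _; apply: lee_sum => j _; apply: intdev.
      by rewrite expn_gt0.
    under eq_bigr do
      rewrite sumEFin sumr_const card_ord -(mulr_natl (V / (2 ^ k)%:R)).
    rewrite sumEFin lee_fin big_const_seq count_predT iter_addr_0.
    rewrite -(mulr_natl (_ * (V / (2 ^ k)%:R))) /C expnS natrM.
    have k0 : 0 < (2 ^ k)%:R :> R by rewrite ltr0n expn_gt0.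
    have -> : 2 * (c%:R * ((2 * q + 1)%:R * V)) / (2 * (2 ^ k)%:R) =
       c%:R * ((2 * q + 1)%:R * (V / (2 ^ k)%:R)) by field; rewrite gt_eqF.
    apply: ler_wpM2r; first by rewrite mulr_ge0// divr_ge0// ltW.
    by rewrite ler_nat; have [] := IP k.
  apply: filterS (ae_cvg0_summable mY Y0 C0 intY) => x Ycvg Dx _ delta d0.
  have [k0 _ k0P] := cvgr_lt _ (Ycvg Dx) _ d0.
  exists k0 => k n j kk nn bn jq; have := k0P k kk; apply: le_lt_trans.
  have [_ /(_ n nn bn) nI] := IP k.
  rewrite /Y (big_rem _ nI)/= (bigD1 (Ordinal jq))//=.
  by rewrite -addrA lerDl addr_ge0// sumr_ge0// => i _; exact: sumr_ge0.
apply: filterS (ae_foralln aeq) => x xP Dx.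
apply/cvgrPdist_lt => eps eps0.
(* Relative to [b n], the error in [window_block_average] is [delta + 2 * (s / b n) * (M + delta)].
   The first term is at most [eps / 3]; as [delta <= 1] and [s / b n <= 1 / q], the choice of [q]
   below gives the same bound for the second. *)
pose delta := Num.min 1 (eps / 3).
have delta0 : 0 < delta by rewrite lt_min ltr01 divr_gt0.
have delta1 : delta <= 1 by rewrite ge_min lexx.
have deltae : delta <= eps / 3 by rewrite ge_min lexx orbT.
pose q := (maxn q0 (Num.bound (6 * (M + 1) / eps))).
have qq : (q0 <= q)%N by exact: leq_maxl.
have q_gt0 : (0 < q)%N by exact: leq_trans qq.
have qM : 2 * (M + 1) <= q%:R * (eps / 3).
  rewrite -ler_pdivrMr ?divr_gt0//.
  have -> : 2 * (M + 1) / (eps / 3) = 6 * (M + 1) / eps by field; rewrite gt_eqF.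
  apply: ltW; apply: lt_le_trans (archi_boundP _) _.
    by rewrite divr_ge0 ?mulr_ge0 ?addr_ge0// ltW.
  by rewrite ler_nat leq_maxr.
have [k0 k0P] := xP q Dx qq _ (exprn_gt0 2 delta0).
have [n1 n1P] := binf (q * 2 ^ k0)%N.
exists (maxn n0 n1) => // n /=; rewrite geq_max => /andP[n0n n1n].
have bn := n1P n n1n.
have bq0 : (0 < b n %/ q)%N.
  by rewrite divn_gt0// (leq_trans _ bn)// leq_pmulr// expn_gt0.
(* The dyadic scale with [q * 2 ^ k <= b n < 2 * q * 2 ^ k]; it is at least [k0] because
   [b n >= q * 2 ^ k0]. *)
pose k := trunc_log 2 (b n %/ q).
have kk : (k0 <= k)%N by apply: trunc_log_max => //; rewrite leq_divRL// mulnC.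
have /andP[k1 k2] := trunc_log_bounds (isT : (1 < 2)%N) bq0.
rewrite -/k in k1 k2.
have bnk : (q * 2 ^ k <= b n < 2 * q * 2 ^ k)%N.
  apply/andP; split; first by rewrite mulnC -leq_divRL.
  by rewrite -[(2 * q)%N]mulnC -mulnA -expnS mulnC -ltn_divLR.
have s0 : (0 < 2 ^ k)%N by rewrite expn_gt0.
have s0' : 0 < (2 ^ k)%:R :> R by rewrite ltr0n.
have /(window_block_average s0 q_gt0 (fun l => X_ge0 l x) M_ge0 (ltW delta0) bnk) key :
    forall j, (j < 2 * q + 1)%N ->
    `|\sum_(o < 2 ^ k) X ((a n %/ 2 ^ k + j) * 2 ^ k + o)%N x - (2 ^ k)%:R * M|
       <= (2 ^ k)%:R * delta.
  move=> j jq; have := k0P k n j kk n0n bnk jq; have delta_ge0 := ltW delta0.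
  rewrite /dev -[ltLHS]real_normK ?num_real// ltr_pXn2r ?nnegrE// normrM normfV.
  by rewrite (gtr0_norm s0') ltr_pdivrMr// [delta * _]mulrC => /ltW.
have b0 : 0 < (b n)%:R :> R.
  rewrite ltr0n; case/andP: bnk => bnk _; apply: leq_trans bnk.
  by rewrite muln_gt0 q_gt0.
rewrite distrC -(ltr_pM2l b0) -{1}(gtr0_norm b0) -normrM mulrBr mulrCA divff ?gt_eqF// mulr1.
apply: le_lt_trans key _.
have : q%:R * (2 ^ k)%:R <= (b n)%:R :> R by rewrite -natrM ler_nat; case/andP: bnk.
move: b0 s0' qM M_ge0 delta0 delta1 deltae eps0.
move: (b n)%:R (2 ^ k)%:R q%:R => B S Q B0 S0 QM M0' d0 d1 de e0 QS.
have h1 : 2 * S * (M + delta) <= 2 * S * (M + 1) by rewrite ler_wpM2l ?lerD2l// mulr_ge0// ltW.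
have h2 : 2 * S * (M + 1) <= S * (Q * (eps / 3)) by nra.
have h3 : S * (Q * (eps / 3)) <= B * (eps / 3) by nra.
have h4 : B * delta <= B * (eps / 3) by rewrite ler_wpM2l// ltW.
nra.
Qed.
End AlmostSureAverages.

(** * Quasi-arithmetic means *)

(** Strict monotonicity makes the generalized inverse continuous even across jumps of [F]: with [x0]
    the inverse at [y], [F (x0 - eps) < y < F (x0 + eps)] persists for nearby values [u n], and when
    [x0 - eps < 0] the lower bound is 0. The point [y1] keeps the set defining [inv_fun F y]
    bounded. *)
Lemma inv_fun_cvg (R : realType) (F : R -> R) (y y1 : R) (u : nat -> R) :
  (forall x z, 0 <= x -> x < z -> F x < F z) -> F 0 <= y -> 0 <= y1 -> y < F y1 ->
  (\forall n \near \oo, F 0 <= u n) -> u @ \oo --> y ->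
  inv_fun F (u n) @[n --> \oo] --> inv_fun F y.
Proof.
move=> Finc F0y y10 yF F0u uy.
pose S z := [set x | 0 <= x /\ F x <= z].
have S0 z : F 0 <= z -> S z 0 by [].
have Sub z x : 0 <= x -> z < F x -> ubound (S z) x.
  move=> x0 zx t [t0 Ft]; rewrite leNgt; apply/negP => xt.
  by have := Finc _ _ x0 xt; lra.
set x0 := inv_fun F y.
have x0_ge0 : 0 <= x0 by apply: ub_le_sup; [exists y1; exact: Sub|exact: S0].
apply/cvgrPdist_le => eps eps0.
have xe : 0 <= x0 + eps by rewrite addr_ge0// ltW.
have yxe : y < F (x0 + eps).
  rewrite ltNge; apply/negP => Fy.
  have : x0 + eps <= x0 by apply: ub_le_sup; [exists y1; exact: Sub|split].
  by lra.
have lo : \forall n \near \oo, x0 - eps <= inv_fun F (u n).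
  have [x0e|x0e] := lerP 0 (x0 - eps).
    have [x [Sx0 Sx1] xx] : exists2 x, S y x & x0 - eps < x.
      by apply: sup_adherent => //; split; [exists 0; exact: S0|exists y1; exact: Sub].
    have Fxy : F (x0 - eps) < y by apply: lt_le_trans (Finc _ _ x0e xx) Sx1.
    near=> n.
    apply: ub_le_sup; first by exists (x0 + eps); apply: Sub => //; near: n; exact: cvgr_lt uy _ yxe.
    by split=> //; apply: ltW; near: n; exact: cvgr_gt uy _ Fxy.
  near=> n.
  apply: (@le_trans _ _ 0); first exact: ltW.
  apply: ub_le_sup; first by exists (x0 + eps); apply: Sub => //; near: n; exact: cvgr_lt uy _ yxe.
  by apply: S0; near: n.
near=> n.
rewrite ler_distlC; apply/andP; split; first by near: n.
apply: ge_sup; first by exists 0; apply: S0; near: n.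
by apply: Sub => //; near: n; exact: cvgr_lt uy _ yxe.
Unshelve. all: by end_near.
Qed.

(** Otherwise [c - g] would be positive on [D] with integral 0, hence zero almost everywhere on a
    set of mass 1. This serves to find a value of [F] above its mean. *)
Lemma integral_not_pointwise_lt d (T : measurableType d) (R : realType)
    (mu : {measure set T -> \bar R}) (D : set T) (g : T -> R) (c : R) :
  measurable D -> mu D = 1%E -> measurable_fun D g ->
  (\int[mu]_(x in D) (g x)%:E = c%:E)%E -> ~ (forall x, D x -> 0 <= g x < c).
Proof.
move=> mD D1 mg gc gltc.
have mEg : measurable_fun D (fun x => (g x)%:E) by apply/measurable_EFinP.
have mcg : measurable_fun D (fun x => (c - g x)%:E).
  by apply/measurable_EFinP; exact: measurable_funB.
have cg0 x : D x -> (0 <= (c - g x)%:E)%E.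
  by move=> /gltc/andP[_ /ltW]; rewrite lee_fin subr_ge0.
have : (\int[mu]_(x in D) (c - g x)%:E + c%:E = 0%:E + c%:E)%E.
  rewrite add0e -{1}gc -ge0_integralD//.
    under eq_integral do rewrite -EFinD subrK.
    by rewrite integral_cst// D1 mule1.
  by move=> x /gltc/andP[]; rewrite lee_fin.
move=> /(congr1 (fun z => z - c%:E)%E); rewrite !addeK// => int0.
have /(ae_eq_integral_abs mu mD mcg) : (\int[mu]_(x in D) `|(c - g x)%:E| = 0)%E.
  apply: etrans int0; apply: eq_integral => x /set_mem Dx.
  by rewrite gee0_abs// cg0.
move=> [A [mA A0 DA]].
have : (mu D <= mu A)%E.
  apply: le_measure; rewrite ?inE// => x Dx; apply: DA => /(_ Dx)/eqP.
  by rewrite eqe subr_eq0 gt_eqF//; case/andP: (gltc x Dx).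
by rewrite D1 A0 lee_fin ler10.
Qed.

(** * From averages of the partial quotients to their quasi-arithmetic means *)

Theorem proposition26 (R : realType) (p : nat) (hp : prime p)
  (Qp : fieldType) (vQp : absolute_value R Qp) (hQp : is_padic p vQp)
  (K : fieldExtType Qp) (m e f : nat) (hm : \dim {:K} = m)
  (v : absolute_value R K) (hv : forall x : Qp, v x%:A = vQp x)
  (he : ramification_index v fullv e) (hf : residue_degree v fullv f)
  (L : {subfield K}) (hLf : \dim L = f) (hLunr : ramification_index v L 1)
  (gamma : K) (hgamma : (p ^ f - 1)%N.-primitive_root gamma)
  (hL : (L : {vspace K}) = <<1; gamma>>%VS)
  (beta : K) (hbeta : v beta = p%:R `^ (e%:R)^-1)
  (hK : <<L; beta>>%VS = fullv)
  (mu : {measure set (borel_of v) -> \bar R}) (hmu : is_haar mu)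
  (hmu1 : mu (unit_ball v) = 1%E)
  (F : R -> R) (hF : forall x y : R, 0 <= x -> x < y -> F x < F y)
  (hF2 : (\int[mu]_(alpha in unit_ball v)
    (`|F (v (partial_quotient p vQp e f gamma beta 1 alpha))| ^+ 2)%:E
      < +oo)%E)
  (a b : nat -> nat) (hab : stoltz R a b) :
  {ae mu, forall alpha, unit_ball v alpha ->
    qa_mean F (fun i : 'I_(b n) =>
        v (partial_quotient p vQp e f gamma beta (a n + i.+1)%N alpha))
      @[n --> \oo]
    --> inv_fun F (\int[mu]_(alpha in unit_ball v)
          F (v (partial_quotient p vQp e f gamma beta 1 alpha)))}.
Proof.
have vU := ext_ultrametric hp hQp hv.
pose fl := floor_part p vQp e f gamma beta.
have flB : forall x, v (x - fl x) < 1 := floor_partB_lt1 hp hQp hv he hf hgamma hbeta.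
have fl_eq : forall x y, v (x - y) < 1 -> fl x = fl y :=
  floor_part_eq hp hQp hv he hf hgamma hbeta.
have [code codeP] := floor_part_code hp hQp hv he hf hgamma hbeta.
(* The element [p] takes the place of [u], whose powers supply the radii of the balls. *)
have p_gt0 : 0 < v p%:R by rewrite (ext_nat hv) absval_gt0 (padic_p_neq0 hp hQp).
have p_lt1 : v p%:R < 1 by rewrite (ext_nat hv) (padic_p_lt1 hp hQp).
have mB := measurable_unit_ball vU.
have F0 x : 0 <= x -> F 0 <= F x.
  by rewrite le_eqVlt => /orP[/eqP <-//|x0]; exact/ltW/hF.
(* Subtracting [F 0] makes the variables nonnegative, as comparison of windows with blocks
   requires. *)
pose psi (c : K) : R := F (v c) - F 0.
have psi_ge0 c : 0 <= psi c by rewrite subr_ge0 F0// absval_ge0.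
pose Y (x : borel_of v) : R := psi (fl (x : K)^-1).
have Y_ge0 x : 0 <= Y x by exact: psi_ge0.
have mY : measurable_fun setT Y by exact: (measurable_quotient vU fl_eq psi 0).
have mEY : measurable_fun setT (EFin \o Y) by apply/measurable_EFinP.
have mY2 : measurable_fun (unit_ball v) (fun x => (Y x ^+ 2)%:E).
  by apply: measurable_funTS; apply/measurable_EFinP; exact: measurable_funX.
(* Square integrability survives the shift by [(s - t) ^+ 2 <= 2 * s ^+ 2 + 2 * t ^+ 2]. *)
have intY2 : (\int[mu]_(x in unit_ball v) (Y x ^+ 2)%:E < +oo)%E.
  apply: (@le_lt_trans _ _ (\int[mu]_(x in unit_ball v) ((2 * `|F (v (fl (x : K)^-1))| ^+ 2)%:E + (cst (2 * F 0 ^+ 2)%:E x))))%E.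
    apply: ge0_le_integral => //.
    - by move=> x _; rewrite lee_fin sqr_ge0.
    - apply: measurable_funTS; apply: emeasurable_funD => //.
      apply/measurable_EFinP.
      exact: (measurable_fun_floor_inv vU fl_eq (fun c => 2 * `|F (v c)| ^+ 2)).
    - move=> x _; rewrite -EFinD lee_fin /Y /psi real_normK ?num_real//.
      have := sqr_ge0 (F (v (fl (x : K)^-1)) + F 0); lra.
  have mF2 : measurable_fun (unit_ball v) (fun x : K => (`|F (v (fl x^-1))| ^+ 2)%:E).
    apply: measurable_funTS; apply/measurable_EFinP.
    exact: (measurable_fun_floor_inv vU fl_eq (fun c => `|F (v c)| ^+ 2)).
  rewrite ge0_integralD//.
  - rewrite integral_cst// hmu1 mule1.
    under eq_integral do rewrite EFinM.
    rewrite ge0_integralZl_EFin//.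
      by rewrite lte_add_pinfty ?ltry// lte_mul_pinfty.
  - by under eq_fun do rewrite EFinM; exact: emeasurable_funM.
  - by move=> x _; rewrite lee_fin mulr_ge0// sqr_ge0.
(* On a set of mass 1 this follows from [Y <= Y ^+ 2 + 1]. *)
have intY : (\int[mu]_(x in unit_ball v) (Y x)%:E < +oo)%E.
  apply: (@le_lt_trans _ _ (\int[mu]_(x in unit_ball v) ((Y x ^+ 2)%:E + (cst 1%E x))))%E.
    apply: ge0_le_integral => //.
    - by move=> x _; rewrite lee_fin.
    - exact: measurable_funTS.
    - exact: emeasurable_funD.
    - by move=> x _; rewrite -EFinD lee_fin; have := sqr_ge0 (Y x - 1); have := Y_ge0 x; nra.
  rewrite ge0_integralD//; last by move=> x _; rewrite lee_fin sqr_ge0.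
  by rewrite integral_cst// hmu1 mule1 lte_add_pinfty// ltry.
have [M YM] : exists M, (\int[mu]_(x in unit_ball v) (Y x)%:E = M%:E)%E.
  eexists; apply/esym/fineK; rewrite ge0_fin_numE//.
  by apply: integral_ge0 => x _; rewrite lee_fin.
have [E2 YE2] : exists E2, (\int[mu]_(x in unit_ball v) (Y x ^+ 2)%:E = E2%:E)%E.
  eexists; apply/esym/fineK; rewrite ge0_fin_numE//.
  by apply: integral_ge0 => x _; rewrite lee_fin sqr_ge0.
have M_ge0 : 0 <= M.
  by rewrite -lee_fin -YM; apply: integral_ge0 => x _; rewrite lee_fin.
have E2_ge0 : 0 <= E2.
  by rewrite -lee_fin -YE2; apply: integral_ge0 => x _; rewrite lee_fin sqr_ge0.
pose X k (x : borel_of v) : R := psi (fl (iter k (fraction_map fl) (x : K))^-1).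
have X_ge0 k x : 0 <= X k x by exact: psi_ge0.
have mX k : measurable_fun setT (X k) by exact: (measurable_quotient vU fl_eq psi k).
have XV := block_variance vU (haar_translation hmu) hmu1 codeP p_gt0 p_lt1 flB fl_eq
  psi_ge0 YM YE2.
have [binf _] := stoltz_blocks hab.
have intF : \int[mu]_(alpha in unit_ball v)
    F (v (partial_quotient p vQp e f gamma beta 1 alpha)) = M + F 0.
  have YI : mu.-integrable (unit_ball v) (EFin \o Y).
    apply/integrableP; split; first exact: measurable_funTS.
    under eq_integral do rewrite gee0_abs ?lee_fin//.
    by rewrite YM ltry.
  rewrite (_ : (fun alpha => _) = (fun x : borel_of v => Y x + cst (F 0) x)).
    rewrite RintegralD//; last first.
      apply/integrableP; split; first exact/measurable_EFinP.
      rewrite (eq_integral (cst `|F 0|%:E))// integral_cst//.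
      by rewrite hmu1 mule1 ltry.
    by rewrite Rintegral_cst// hmu1 /= mulr1 /Rintegral YM.
  by apply/funext => x; rewrite /Y /psi subrK.
(* If no value of [F] exceeded the mean, then [F (v c) < F (v c + 1) <= M + F 0] for every quotient
   [c], so [Y] would lie strictly below its own mean everywhere. *)
have [y1 [y10 My1]] : exists y1, 0 <= y1 /\ M + F 0 < F y1.
  apply: contrapT => nF; apply: (integral_not_pointwise_lt mB hmu1 (measurable_funTS mY) YM) => x _.
  rewrite Y_ge0/= ltNge; apply/negP => MY.
  have v0 := absval_ge0 v (fl (x : K)^-1).
  apply: nF; exists (v (fl (x : K)^-1) + 1); split; first by rewrite addr_ge0.
  have : F (v (fl (x : K)^-1)) < F (v (fl (x : K)^-1) + 1) by apply: hF; rewrite // ltrDl.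
  by move: MY; rewrite /Y /psi; lra.
rewrite intF.
apply: filterS (stoltz_averages_cvg mB mX X_ge0 M_ge0 E2_ge0 XV hab) => x xcvg Bx.
(* For an empty window the quotient by 0 is 0 and would not absorb the shift by [F 0]; the windows
   are eventually nonempty. *)
have [n1 n1P] := binf 1%N.
have avgE n : (n1 <= n)%N ->
    (\sum_(i < b n) F (v (partial_quotient p vQp e f gamma beta (a n + i.+1)%N x))) / (b n)%:R
    = (\sum_(l < b n) X (a n + l)%N x) / (b n)%:R + F 0.
  move=> /n1P bn; have b0 : (b n)%:R != 0 :> R by rewrite pnatr_eq0 -lt0n.
  apply: (mulIf b0); rewrite mulrDl !divfK//.
  rewrite [F 0 * _]mulr_natr -[X in _ *+ X]card_ord -sumr_const -big_split/=.
  by apply: eq_bigr => i _; rewrite /X /psi subrK addnS.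
apply: (inv_fun_cvg hF _ y10 My1); first by rewrite lerDr.
- by exists n1 => // n /= nn; rewrite avgE// lerDr divr_ge0// sumr_ge0.
- apply: cvg_trans (cvgD (xcvg Bx) (cvg_cst (F 0))).
  apply: near_eq_cvg; exists n1 => // n /= nn.
  by rewrite avgE.
Qed.
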